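(* Let $G$ be a Polish group. If, for some $n\geq 1$, $L_0(G)$ has a comeager $n$-dimensional diagonal conjugacy class, then $G$ has a comeager $n$-dimensional diagonal conjugacy class (for the same $n$). In particular, if $L_0(G)$ has ample generics, then $G$ has ample generics.
   Context: A Polish group is a separable and completely metrizable topological group. Let $\mu$ be the Lebesgue measure on $[0,1]$. For a Polish group $G$, $L_0(G)$ is the Polish group of all $\mu$-equivalence classes (equality $\mu$-almost everywhere) of $\mu$-measurable functions $[0,1]\to G$, with pointwise multiplication and the topology of convergence in measure: a basic neighbourhood of the identity is $\{f\in L_0(G)\colon \mu(\{x\in[0,1]\colon f(x)\notin V\})<\epsilon\}$, where $V$ is a neighbourhood of the identity in $G$ and $\epsilon>0$. For a Polish group $H$ and $n\geq 1$, the $n$-diagonal conjugation action of $H$ on $H^n$ is $g.(h_1,\ldots,h_n)=(gh_1g^{-1},\ldots,gh_ng^{-1})$; its orbits are the $n$-dimensional diagonal conjugacy classes of $H$. $H$ has a comeager $n$-dimensional diagonal conjugacy class if some such orbit is comeager in $H^n$. $H$ has ample generics if it has a comeager $n$-dimensional diagonal conjugacy class for every $n\geq 1$. *)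

(* Defs.v *)
From HB Require Import structures.
From mathcomp Require Import all_boot all_order all_algebra.
From mathcomp Require Import all_classical all_reals all_analysis.

Set Implicit Arguments.
Unset Strict Implicit.
Unset Printing Implicit Defensive.

Import Order.TTheory GRing.Theory Num.Theory numFieldNormedType.Exports.

Local Open Scope classical_set_scope.
Local Open Scope ring_scope.

Section category.
Context {T : topologicalType}.
Implicit Types A : set T.

Definition nowhere_dense A := (closure A)° = set0.

Definition meager A :=
  exists2 F : nat -> set T, (forall i, nowhere_dense (F i)) & A = \bigcup_i F i.

Definition comeager A := meager (~` A).

Lemma nowhere_denseP A : nowhere_dense A <-> dense (~` closure A).
Proof.
split=> [A0 O [x Ox] oO|dA].
  apply: contrapT => /set0P/negP; rewrite negbK => /eqP OA.
  suff : set0 x by [].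
  rewrite -A0; apply: filterS (open_nbhs_nbhs (conj oO Ox)) => y Oy.
  apply: contrapT => nAy; suff : set0 y by [].
  by rewrite -OA; split.
apply: contrapT => /eqP/set0P[x Ax].
have [y [Ay]] := dA (closure A)° (ex_intro _ x Ax) (open_interior _).
by apply; exact: interior_subset.
Qed.

Lemma comeagerP A : comeager A <->
  exists2 U : nat -> set T, (forall i, open (U i) /\ dense (U i)) &
    \bigcap_i U i `<=` A.
Proof.
split=> [[F Fnd FE]|[U Uod UA]].
  exists (fun i => ~` closure (F i)) => [i|x Ux].
    split; last exact/nowhere_denseP.
    exact/closed_openC/closed_closure.
  apply: contrapT => nAx; have : (~` A) x by [].
  by rewrite FE => -[i _ Fix]; apply: (Ux i) => //; exact: subset_closure.
exists (fun i => ~` A `&` ~` U i) => [i|]; last first.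
  rewrite -setI_bigcupr -setC_bigcap; apply/esym/setIidPl.
  exact: subsetC.
apply/nowhere_denseP => O O0 oO; have [oU dU] := Uod i.
have [x [Ox Ux]] := dU O O0 oO; exists x; split=> //.
move=> clx; have : closure (~` U i) x by apply: closure_subset clx => y [].
by rewrite -(closure_id _).1//; exact: open_closedC.
Qed.

End category.

Definition separable (T : topologicalType) :=
  exists2 D : set T, countable D & dense D.

Section metrizability.
Context {R : realType} {T : topologicalType}.
Implicit Types d : T -> T -> R.

Definition is_metric d :=
  [/\ forall x y, d x y = 0 <-> x = y,
      forall x y, d x y = d y x &
      forall x y z, d x z <= d x y + d y z].

Definition metrizes d := forall x (A : set T),
  nbhs x A <-> exists2 e, 0 < e & [set y | d x y < e] `<=` A.

Definition metric_complete d := forall u : nat -> T,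
  (forall e, 0 < e -> exists N, forall m n, (N <= m)%N -> (N <= n)%N ->
     d (u m) (u n) < e) ->
  exists l : T, u @ \oo --> l.

End metrizability.

Definition completely_metrizable (R : realType) (T : topologicalType) :=
  exists d : T -> T -> R, [/\ is_metric d, metrizes d & metric_complete d].

HB.mixin Record isTopologicalGroup G & Group G & Topological G := {
  mulg_continuous : continuous (fun x : G * G => (x.1 * x.2)%g) ;
  invg_continuous : continuous (fun x : G => x^-1%g)
}.

#[short(type="topologicalGroupType")]
HB.structure Definition TopologicalGroup :=
  {G of Group G & Topological G & isTopologicalGroup G}.

HB.mixin Record isPolish (R : realType) G & Topological G := {
  polish_separable : separable G ;
  polish_completely_metrizable : completely_metrizable R G
}.

#[short(type="polishGroupType")]
HB.structure Definition PolishGroup (R : realType) :=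
  {G of TopologicalGroup G & isPolish R G}.

Section polish_theory.
Context {R : realType} {G : topologicalType} (d : G -> G -> R).
Hypotheses (dm : is_metric d) (dt : metrizes d).

Let dxx x : d x x = 0. Proof. by case: dm => d0 _ _; exact/d0. Qed.
Let dC x y : d x y = d y x. Proof. by case: dm. Qed.
Let dD x y z : d x z <= d x y + d y z. Proof. by case: dm. Qed.

Lemma metric_ball_open a e : open [set y | d a y < e].
Proof.
rewrite openE => y /= aye; rewrite /interior; apply/dt.
exists (e - d a y); first by rewrite subr_gt0.
by move=> z /=; rewrite ltrBrDl; exact/le_lt_trans.
Qed.

Lemma metric_gt_open a e : open [set y | e < d a y].
Proof.
rewrite openE => y /= eay; rewrite /interior; apply/dt.
exists (d a y - e); first by rewrite subr_gt0.
move=> z /=; rewrite ltrBrDr -ltrBrDl => /lt_le_trans; apply.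
by rewrite lerBlDr [d y z]dC.
Qed.

Lemma metric_ball_nbhs a e : 0 < e -> nbhs a [set y | d a y < e].
Proof. by move=> e0; apply/dt; exists e. Qed.

Lemma separable_dense_seq (x0 : G) : separable G ->
  exists s : nat -> G, forall x e, 0 < e -> exists n, d (s n) x < e.
Proof.
move=> [D cD dD'].
have [s sD] : exists s : nat -> G, D `<=` range s.
  have /pcard_leP[f] := cD.
  have fi : {in D &, injective f} by exact: inj.
  have /choice[s sE] : forall n, exists y, forall x, D x -> f x = n -> y = x.
    move=> n; have [[x [Dx <-]]|nx] := pselect (exists x, D x /\ f x = n).
      by exists x => y Dy /esym fxy; apply: fi => //; exact: mem_set.
    by exists x0 => x Dx fx; exfalso; apply: nx; exists x.
  by exists s => x Dx; exists (f x) => //; exact: sE.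
exists s => x e e0.
have [y [/= xy /sD[n _ sn]]] :=
  dD' _ (ex_intro _ x (nbhs_singleton (metric_ball_nbhs x e0)))
      (metric_ball_open x e).
by exists n; rewrite sn dC.
Qed.

End polish_theory.

(* The real line with the sigma-algebra of Lebesgue measurable (not only Borel)
   sets, on which completed_lebesgue_measure is defined. *)
Definition lebesgueR (R : realType) : Type :=
  caratheodory_type ((wlength (@idfun R))^*)%mu.
HB.instance Definition _ R := Measurable.on (lebesgueR R).

Definition I01 {R : realType} : set (lebesgueR R) := `[0%R, 1%R].

Section unit_interval.
Context {R : realType}.
Local Notation mu := (@completed_lebesgue_measure R).

Lemma lebesgueR_measurable (A : set R) :
  measurable A -> measurable (A : set (lebesgueR R)).
Proof. exact: sub_caratheodory. Qed.

Lemma measurable_I01 : measurable (@I01 R).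
Proof. by apply: lebesgueR_measurable; exact: measurable_itv. Qed.

Lemma mu_I01 : mu I01 = 1%E.
Proof.
rewrite -[LHS]/(@lebesgue_measure R `[0%R, 1%R]%classic).
by rewrite lebesgue_measure_itv/= lte01 -EFinD subr0.
Qed.

End unit_interval.

Definition lebesgue_measurable_fun {R : realType} {G : topologicalType}
    (f : lebesgueR R -> G) :=
  forall U : set G, open U -> measurable (I01 `&` f @^-1` U).

(* Functions [0,1] -> G are represented by total functions on the line; only
   their restriction to I01 is constrained, and ae_eq01 below ignores the values
   outside I01. *)
Record L0fun (R : realType) (G : topologicalType) := MkL0fun {
  L0fun_val :> lebesgueR R -> G ;
  L0fun_measurable : lebesgue_measurable_fun L0fun_val
}.

HB.instance Definition _ R G := gen_eqMixin (L0fun R G).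
HB.instance Definition _ R G := gen_choiceMixin (L0fun R G).

Section L0_quotient.
Context (R : realType) (G : topologicalType).

Definition ae_eq01 (f g : L0fun R G) : bool :=
  `[< f = g %[ae completed_lebesgue_measure in I01] >].

Let ae_eq01_refl : reflexive ae_eq01.
Proof. by move=> f; apply/asboolP; exact: aeW. Qed.

Let ae_eq01_sym : symmetric ae_eq01.
Proof.
by move=> f g; apply/idP/idP => /asboolP fg; apply/asboolP;
  apply: filterS fg => x fg /fg.
Qed.

Let ae_eq01_trans : transitive ae_eq01.
Proof.
move=> g f h /asboolP fg /asboolP gh; apply/asboolP.
by apply: filterS2 fg gh => x fg gh Ix; rewrite fg// gh.
Qed.

Canonical ae_eq01_equiv :=
  EquivRel ae_eq01 ae_eq01_refl ae_eq01_sym ae_eq01_trans.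

Local Open Scope quotient_scope.

Definition L0 : Type := {eq_quot ae_eq01}.
HB.instance Definition _ := Choice.on L0.
HB.instance Definition _ := EqQuotient.on L0.

Lemma L0_eqP (f g : L0fun R G) : \pi_L0 f = \pi_L0 g <->
  f = g %[ae completed_lebesgue_measure in I01].
Proof. by split=> [/eqmodP/asboolP//|fg]; apply/eqmodP/asboolP. Qed.

Lemma repr_pi_ae (f : L0fun R G) :
  repr (\pi_L0 f) = f %[ae completed_lebesgue_measure in I01].
Proof. by apply/L0_eqP; rewrite reprK. Qed.

End L0_quotient.

Section L0_group.
Context (R : realType) (G : polishGroupType R).
Implicit Types f g h : L0fun R G.
Local Open Scope quotient_scope.
Local Notation cl := (\pi_(L0 R G)).

Let cst_measurable (a : G) :
  lebesgue_measurable_fun (fun _ : lebesgueR R => a).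
Proof.
move=> U oU; have [Ua|nUa] := pselect (U a).
  rewrite (_ : _ `&` _ = I01); first exact: measurable_I01.
  by apply/seteqP; split=> [x []|x Ix].
rewrite (_ : _ `&` _ = set0); first exact: measurable0.
by apply/seteqP; split=> [x []|x []].
Qed.

Let comp_measurable (f : lebesgueR R -> G) (k : G -> G) : continuous k ->
  lebesgue_measurable_fun f -> lebesgue_measurable_fun (k \o f).
Proof. by move=> /continuousP kc fm U oU; apply: (fm (k @^-1` U)); exact: kc. Qed.

(* The product map is Borel measurable for the product sigma-algebra because
   the topology of G has a countable basis. *)
Let mul_measurable (f g : lebesgueR R -> G) :
  lebesgue_measurable_fun f -> lebesgue_measurable_fun g ->
  lebesgue_measurable_fun (fun x => f x * g x)%g.
Proof.
move=> fm gm U oU.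
have [d [dm dt _]] := @polish_completely_metrizable R G.
have [s sd] := separable_dense_seq dm dt 1%g (@polish_separable R G).
have [d0 dC dD] := dm.
pose B n k := [set y | d (s n) y < k.+1%:R^-1].
have nbB a A : nbhs a A -> exists n k, B n k a /\ B n k `<=` A.
  move=> /dt[e e0 eA].
  have e20 : 0 < e / 2 by rewrite divr_gt0.
  have [k _ /(_ k)/(_ (leqnn _)) /= ke] := near_infty_natSinv_lt (PosNum e20).
  have [n sna] := sd a k.+1%:R^-1 (ltac:(by [])).
  exists n, k; split=> // y sny; apply: eA => /=.
  rewrite (le_lt_trans (dD a (s n) y))// [e]splitr ltrD//.
    by rewrite dC; apply: lt_trans ke.
  exact: lt_trans ke.
pose P (p : nat * nat * (nat * nat)) := forall y z,
  B p.1.1 p.1.2 y -> B p.2.1 p.2.2 z -> U (y * z)%g.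
have -> : I01 `&` (fun x => f x * g x)%g @^-1` U =
  \bigcup_(p : nat * nat * (nat * nat))
     [set x | (I01 `&` f @^-1` B p.1.1 p.1.2) x /\
              (I01 `&` g @^-1` B p.2.1 p.2.2) x /\ P p].
  apply/seteqP; split=> [x [Ix /= Ux]|x [p _ [[Ix fx] [[_ gx] Pp]]]]; last first.
    by split=> //; exact: Pp.
  have := @mulg_continuous G (f x, g x) U (open_nbhs_nbhs (conj oU Ux)).
  case=> -[A C] /= [/nbB[n [k [fn nA]]] /nbB[m [l [gm' mC]]]] AC.
  exists ((n, k), (m, l)) => //=; split=> //; split=> // y z yB zB.
  by apply: (AC (y, z)); split; [exact: nA|exact: mC].
apply: countable_bigcupT_measurable; first exact: countableP.
move=> p; have [Pp|nPp] := pselect (P p); last first.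
  rewrite (_ : [set x | _] = set0); first exact: measurable0.
  by apply/seteqP; split=> // x [_ []].
rewrite (_ : [set x | _] = (I01 `&` f @^-1` B p.1.1 p.1.2) `&`
                           (I01 `&` g @^-1` B p.2.1 p.2.2)).
  by apply: measurableI; [apply: fm|apply: gm]; exact: metric_ball_open.
by apply/seteqP; split=> [x [? []]|x []].
Qed.

Definition L0fun_one : L0fun R G := MkL0fun (cst_measurable 1%g).
Definition L0fun_inv f : L0fun R G :=
  MkL0fun (comp_measurable (@invg_continuous G) (@L0fun_measurable R G f)).
Definition L0fun_mul f g : L0fun R G :=
  MkL0fun (mul_measurable (@L0fun_measurable R G f) (@L0fun_measurable R G g)).

Definition L0_one : L0 R G := cl L0fun_one.
Definition L0_inv (a : L0 R G) : L0 R G := cl (L0fun_inv (repr a)).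
Definition L0_mul (a b : L0 R G) : L0 R G := cl (L0fun_mul (repr a) (repr b)).

Lemma L0_invE f : L0_inv (cl f) = cl (L0fun_inv f).
Proof.
by apply/L0_eqP; apply: filterS (repr_pi_ae f) => x fx Ix /=; rewrite fx.
Qed.

Lemma L0_mulE f g : L0_mul (cl f) (cl g) = cl (L0fun_mul f g).
Proof.
apply/L0_eqP; apply: filterS2 (repr_pi_ae f) (repr_pi_ae g) => x fx gx Ix /=.
by rewrite fx// gx.
Qed.

Let L0_ind (P : L0 R G -> Prop) : (forall f, P (cl f)) -> forall a, P a.
Proof. by move=> Pf a; rewrite -(reprK a). Qed.

Let mulA : associative L0_mul.
Proof.
elim/L0_ind=> f; elim/L0_ind=> g; elim/L0_ind=> h; rewrite !L0_mulE.
by apply/L0_eqP/aeW => x _ /=; rewrite mulgA.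
Qed.

Let mul1 : left_id L0_one L0_mul.
Proof.
by elim/L0_ind=> f; rewrite L0_mulE; apply/L0_eqP/aeW => x _ /=; rewrite mul1g.
Qed.

Let mul1r : right_id L0_one L0_mul.
Proof.
by elim/L0_ind=> f; rewrite L0_mulE; apply/L0_eqP/aeW => x _ /=; rewrite mulg1.
Qed.

Let mulV : left_inverse L0_one L0_inv L0_mul.
Proof.
elim/L0_ind=> f; rewrite L0_invE L0_mulE.
by apply/L0_eqP/aeW => x _ /=; rewrite mulVg.
Qed.

Let mulVr : right_inverse L0_one L0_inv L0_mul.
Proof.
elim/L0_ind=> f; rewrite L0_invE L0_mulE.
by apply/L0_eqP/aeW => x _ /=; rewrite mulgV.
Qed.

HB.instance Definition _ := isGroup.Build (L0 R G) mulA mul1 mul1r mulV mulVr.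

End L0_group.

Section L0_topology.
Context (R : realType) (G : polishGroupType R).
Implicit Types (V W : set G) (a b u v : L0 R G).
Local Open Scope quotient_scope.
Local Notation cl := (\pi_(L0 R G)).
Local Notation mu := (@completed_lebesgue_measure R).
Local Notation bad V f := (I01 `&` [set x | ~ V (f x)]).

(* Restricting to open V loses nothing (smaller V give smaller sets) and makes
   the set whose measure is taken measurable. *)
Definition L0_small (p : set G * R) : set (L0 R G) :=
  [set a : L0 R G | (mu (bad p.1 (repr a : L0fun R G)) < p.2%:E)%E].

Definition L0_small_index : set (set G * R) :=
  [set p | open_nbhs 1%g p.1 /\ 0 < p.2].

(* Left translates of the basic neighbourhoods of the identity. *)
Definition L0_nbhs a : set_system (L0 R G) :=
  filter_from L0_small_index (fun p => [set b | L0_small p (a^-1 * b)%g]).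

Let bad_measurable V (f : L0fun R G) : open V -> measurable (bad V f).
Proof.
move=> oV.
rewrite (_ : bad V f = I01 `\` (I01 `&` f @^-1` V)).
  apply: measurableD; first exact: measurable_I01.
  exact: L0fun_measurable.
apply/seteqP; split=> x [Ix nV]; split=> //.
  by case.
by move=> Vx; apply: nV.
Qed.

Lemma L0_small_pi V (e : R) (f : L0fun R G) : open V ->
  L0_small (V, e) (cl f) <-> (mu (bad V f) < e%:E)%E.
Proof.
move=> oV; rewrite /L0_small /=; suff -> : mu (bad V (repr (cl f) : L0fun R G)) = mu (bad V f) by [].
have [N [mN N0 fN]] := repr_pi_ae f.
apply/eqP; rewrite eq_le; apply/andP; split.
  rewrite -[leRHS]adde0 -N0; apply: le_trans (measureU2 _ _ _) => //;
    last exact: bad_measurable.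
  apply: le_measure; rewrite ?inE; [exact: bad_measurable| |].
    by apply: measurableU => //; exact: bad_measurable.
  move=> x [Ix nV]; have [Nx|nNx] := pselect (N x); [by right|left].
  split=> //= Vf; apply: nV; have [|fx] := pselect (repr (cl f) x = f x).
    by move=> ->.
  by exfalso; apply: nNx; apply: fN => /= /(_ Ix).
rewrite -[leRHS]adde0 -N0; apply: le_trans (measureU2 _ _ _) => //;
  last exact: bad_measurable.
apply: le_measure; rewrite ?inE; [exact: bad_measurable| |].
  by apply: measurableU => //; exact: bad_measurable.
move=> x [Ix nV]; have [Nx|nNx] := pselect (N x); [by right|left].
split=> //= Vf; apply: nV; have [|fx] := pselect (repr (cl f) x = f x).
  by move=> <-.
by exfalso; apply: nNx; apply: fN => /= /(_ Ix).
Qed.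

Let L0_mulE' (f g : L0fun R G) : (cl f * cl g)%g = cl (L0fun_mul f g).
Proof. exact: L0_mulE. Qed.

Let L0_invE' (f : L0fun R G) : (cl f)^-1%g = cl (L0fun_inv f).
Proof. exact: L0_invE. Qed.

Let nbhs1_open V : nbhs (1%g : G) V -> exists2 W, open_nbhs 1%g W & W `<=` V.
Proof. by rewrite nbhsE. Qed.

Let small1 p : L0_small_index p -> L0_small p 1%g.
Proof.
case: p => V e [/= [oV V1] e0]; apply/L0_small_pi => //=.
rewrite (_ : bad V _ = set0) ?measure0 ?lte_fin//.
by apply/seteqP; split=> // x [].
Qed.

Let small_sub p q : L0_small_index p -> L0_small_index q -> q.1 `<=` p.1 -> q.2 <= p.2 ->
  L0_small q `<=` L0_small p.
Proof.
case: p q => V e [W r] [/= [oV _] _] [/= [oW _] _] WV re a.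
rewrite /L0_small/= => /lt_le_trans; rewrite -lee_fin in re => /(_ _ re).
apply: le_lt_trans; apply: le_measure; rewrite ?inE; try exact: bad_measurable.
by move=> x [Ix nV]; split=> // /WV.
Qed.

Let small_mul p : L0_small_index p -> exists2 q, L0_small_index q &
  forall u v, L0_small q u -> L0_small q v -> L0_small p (u * v)%g.
Proof.
case: p => V e [/= [oV V1] e0].
have : nbhs ((1%g : G) * 1%g)%g V by rewrite mulg1; exact: open_nbhs_nbhs.
case/(@mulg_continuous G (1%g, 1%g)) => -[A B] /= [].
move=> /nbhs1_open[A' A'1 A'A] /nbhs1_open[B' B'1 B'B] AB.
exists (A' `&` B', e / 2).
  by split=> /=; [exact: open_nbhsI|rewrite divr_gt0].
have [oW _] : open_nbhs 1%g (A' `&` B') by exact: open_nbhsI.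
move=> u v; rewrite -(reprK u) -(reprK v).
move: (repr u) (repr v) => f g /(L0_small_pi _ _ oW) fW /(L0_small_pi _ _ oW) gW.
rewrite L0_mulE'; apply/L0_small_pi => //.
apply: (@le_lt_trans _ _ (mu (bad (A' `&` B') f `|` bad (A' `&` B') g))).
  apply: le_measure; rewrite ?inE; [exact: bad_measurable| |].
    by apply: measurableU; exact: bad_measurable.
  move=> x [Ix nV].
  have [fx|nfx] := pselect ((A' `&` B') (f x)); [right|by left].
  split=> // gx; apply: nV; apply: (AB (f x, g x)).
  by split; [apply: A'A; case: fx|apply: B'B; case: gx].
rewrite [e]splitr EFinD; apply: le_lt_trans (measureU2 _ _ _) _; try exact: bad_measurable.
exact: lteD.
Qed.

Let small_inv p : L0_small_index p -> exists2 q, L0_small_index q &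
  forall u, L0_small q u -> L0_small p (u^-1)%g.
Proof.
case: p => V e [/= [oV V1] e0].
have oW : open ((fun x : G => x^-1%g) @^-1` V).
  by have /continuousP := @invg_continuous G; apply.
exists ((fun x : G => x^-1%g) @^-1` V, e).
  by split=> //=; split=> //=; rewrite invg1.
move=> u; rewrite -(reprK u) => /(L0_small_pi _ _ oW) uW.
by rewrite L0_invE'; apply/L0_small_pi.
Qed.

Let small_conj a p : L0_small_index p -> exists2 q, L0_small_index q &
  forall u, L0_small q u -> L0_small p (a^-1 * u * a)%g.
Proof.
case: p => V e [/= [oV V1] e0].
have [d [dm dt _]] := @polish_completely_metrizable R G.
have [d0 dC dD] := dm.
have d11 : d 1%g 1%g = 0 by exact/d0.
have /dt[r r0 rV] : nbhs 1%g V by exact: open_nbhs_nbhs.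
pose W n := [set y | d 1%g y < n.+1%:R^-1].
have W1 n : open_nbhs 1%g (W n).
  by split; [exact: metric_ball_open|rewrite /W/= d11 invr_gt0].
have conj_cont (y z : G) :
    {for z, continuous (fun t => t^-1 * y * t)%g} * {for y, continuous (fun t => z^-1 * t * z)%g}.
  split.
    apply: (@continuous2_cvg _ _ _ _ _ _ (fun t => t^-1 * y)%g id (fun s t => s * t)%g).
    - exact: (@mulg_continuous G (z^-1 * y, z)%g).
    - apply: (@continuous2_cvg _ _ _ _ _ _ (fun t => t^-1)%g (fun _ => y) (fun s t => s * t)%g).
      + exact: (@mulg_continuous G (z^-1, y)%g).
      + exact: invg_continuous.
      + exact: cvg_cst.
    - exact: cvg_id.
  apply: (@continuous2_cvg _ _ _ _ _ _ (fun t => z^-1 * t)%g (fun _ => z) (fun s t => s * t)%g).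
  - exact: (@mulg_continuous G (z^-1 * y, z)%g).
  - apply: (@continuous2_cvg _ _ _ _ _ _ (fun _ => z^-1)%g id (fun s t => s * t)%g).
    + exact: (@mulg_continuous G (z^-1, y)%g).
    + exact: cvg_cst.
    + exact: cvg_id.
  - exact: cvg_cst.
pose H n := [set z : G | exists2 y, W n y & r / 2 < d 1%g (z^-1 * y * z)%g].
have oH n : open (H n).
  rewrite (_ : H n = \bigcup_(y in W n) (fun z => z^-1 * y * z)%g @^-1` [set t | r / 2 < d 1%g t]).
    apply: bigcup_open => y _; apply: open_comp; last exact: metric_gt_open.
    by move=> z _; exact: (conj_cont y z).1.
  by apply/seteqP; split=> [z [y]|z [y]]; exists y.
rewrite -(reprK a); move: (repr a) => f.
pose E n := I01 `&` f @^-1` H n.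
have mE n : measurable (E n) by exact: L0fun_measurable.
have E0 : \bigcap_n E n = set0.
  apply/seteqP; split=> // x Ex.
  have r20 : 0 < r / 2 by rewrite divr_gt0.
  have : nbhs ((f x)^-1 * 1 * f x)%g [set t | d 1%g t < r / 2].
    by rewrite mulg1 mulVg; exact: metric_ball_nbhs.
  move=> /((conj_cont 1%g (f x)).2) /dt[s s0 sr].
  have [n _ /(_ n)/(_ (leqnn _)) /= ns] := near_infty_natSinv_lt (PosNum s0).
  have [_ [y Wy]] := Ex n I; apply/negP; rewrite -leNgt ltW//.
  by apply: sr => /=; exact: lt_trans ns.
have : mu (E n) @[n --> \oo] --> mu (\bigcap_n E n).
  apply: nonincreasing_cvg_mu => //.
  - apply: (@le_lt_trans _ _ (mu I01)); last by rewrite mu_I01 ltry.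
    apply: le_measure; rewrite ?inE; [exact: mE|exact: measurable_I01|].
    by move=> x [].
  - by rewrite E0.
  - move=> n m nm; apply/subsetPset => x [Ix [y Wy ry]]; split=> //; exists y => //.
    by apply: lt_le_trans Wy _; rewrite lef_pV2 ?posrE// ler_nat ltnS.
rewrite E0 measure0 => E_cvg.
have e20 : 0 < e / 2 by rewrite divr_gt0.
have [n En] : exists n, (mu (E n) < (e / 2)%:E)%E.
  have : nbhs (0%E : \bar R) [set t | (t < (e / 2)%:E)%E].
    by apply: open_nbhs_nbhs; split; [exact: open_ereal_lt_ereal|rewrite /= lte_fin].
  by move=> /E_cvg [n _ /(_ n (leqnn _))]; exists n.
exists (W n, e / 2); first by split; [exact: W1|exact: e20].
move=> u; rewrite -(reprK u); move: (repr u) => g /(L0_small_pi _ _ (W1 n).1) gW.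
rewrite L0_invE' (L0_mulE' (L0fun_inv f) g) (L0_mulE' _ f); apply/L0_small_pi => //.
apply: (@le_lt_trans _ _ (mu (bad (W n) g `|` E n))).
  apply: le_measure; rewrite ?inE; [exact: bad_measurable| |].
    by apply: measurableU => //; apply: bad_measurable; exact: (W1 n).1.
  move=> x [Ix nV].
  have [gx|ngx] := pselect (W n (g x)); [right|by left].
  split=> //; exists (g x) => //; rewrite ltNge; apply/negP => dr.
  apply: nV; apply: rV => /=.
  by apply: (le_lt_trans dr); rewrite ltr_pdivrMr// ltr_pMr// ltr1n.
rewrite [e]splitr EFinD; apply: le_lt_trans (measureU2 _ _ _) _ => //.
  by apply: bad_measurable; exact: (W1 n).1.
exact: lteD.
Qed.

Let index_nonempty : L0_small_index (setT, 1).
Proof. by split=> //=; split=> //; exact: openT. Qed.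

Let indexI p q : L0_small_index p -> L0_small_index q ->
  exists2 r, L0_small_index r & L0_small r `<=` L0_small p `&` L0_small q.
Proof.
move=> pi qi; have [[pV p0] [qV q0]] := (pi, qi).
have ri : L0_small_index (p.1 `&` q.1, Num.min p.2 q.2).
  by split=> /=; [exact: open_nbhsI|rewrite lt_min p0].
exists (p.1 `&` q.1, Num.min p.2 q.2) => //.
by move=> a ra; split; apply: small_sub ra => //=;
  rewrite ?ge_min ?lexx ?orbT//; move=> x [].
Qed.

Let L0_nbhs_filter a : ProperFilter (L0_nbhs a).
Proof.
apply: filter_from_proper; last first.
  by move=> p pi; exists a => /=; rewrite mulVg; exact: small1.
apply: filter_from_filter; first by exists (setT, 1).
move=> p q pi qi; have [r ri rpq] := indexI pi qi.
by exists r => // b /rpq[].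
Qed.

Let L0_nbhs_singleton a (A : set (L0 R G)) : L0_nbhs a A -> A a.
Proof. by case=> p pi; apply=> /=; rewrite mulVg; exact: small1. Qed.

Let L0_nbhs_nbhs a (A : set (L0 R G)) : L0_nbhs a A -> L0_nbhs a (L0_nbhs^~ A).
Proof.
case=> p pi pA; have [q qi qp] := small_mul pi.
exists q => // b /= qb; exists q => // c /= qc; apply: pA => /=.
by have := qp _ _ qb qc; rewrite -mulgA mulVKg.
Qed.

HB.instance Definition _ := hasNbhs.Build (L0 R G) L0_nbhs.
HB.instance Definition _ := Nbhs_isNbhsTopological.Build (L0 R G)
  L0_nbhs_filter L0_nbhs_singleton L0_nbhs_nbhs.

Let L0_mul_continuous :
  continuous (fun x : L0 R G * L0 R G => (x.1 * x.2)%g).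
Proof.
move=> [a b] A [p pi pA].
have [q qi qp] := small_mul pi; have [s si sq] := small_conj b qi.
exists ([set c | L0_small s (a^-1 * c)%g], [set c | L0_small q (b^-1 * c)%g]).
  by split; [exists s|exists q].
move=> [c c'] [/= /sq sc qc]; apply: pA => /=.
have := qp _ _ sc qc; congr (L0_small p _).
by rewrite invgM -!mulgA mulVKg.
Qed.

Let L0_inv_continuous : continuous (fun a : L0 R G => a^-1%g).
Proof.
move=> a A [p pi pA].
have [q qi qp] := small_conj a^-1%g pi; have [s si sq] := small_inv qi.
exists s => // b /= /sq/qp; rewrite invgM !invgK => pab; apply: pA => /=.
by move: pab; rewrite invgK -!mulgA mulgV mulg1.
Qed.

HB.instance Definition _ := isTopologicalGroup.Build (L0 R G)
  L0_mul_continuous L0_inv_continuous.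

End L0_topology.

Lemma L0_nbhs1P (R : realType) (G : polishGroupType R) (A : set (L0 R G)) :
  nbhs 1%g A <-> exists V e, [/\ open_nbhs 1%g V, 0 < e &
    [set a : L0 R G | (completed_lebesgue_measure
      (I01 `&` [set x | ~ V ((repr a : L0fun R G) x)]) < e%:E)%E] `<=` A].
Proof.
have mulV1 (a : L0 R G) : (1^-1 * a)%g = a by rewrite invg1 mul1g.
split=> [[[V e] [/= V1 e0] VA]|[V [e [V1 e0 VA]]]].
  exists V, e; split=> // a Va; apply: VA.
  by change (L0_small (V, e) (1^-1 * a)%g); rewrite mulV1.
exists (V, e) => // a aV; apply: VA.
by change (L0_small (V, e) a); rewrite -(mulV1 a).
Qed.

Section diagonal_conjugation.
Context (H : topologicalGroupType) (n : nat).

Definition diag_conj (g : H) (h : {ptws 'I_n -> H}) : {ptws 'I_n -> H} :=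
  fun i => (g * h i * g^-1)%g.

Definition diag_class (h : {ptws 'I_n -> H}) : set {ptws 'I_n -> H} :=
  range (diag_conj^~ h).

Definition has_comeager_diag_class :=
  exists h : {ptws 'I_n -> H}, comeager (diag_class h).

End diagonal_conjugation.

Definition ample_generics (H : topologicalGroupType) :=
  forall n, (1 <= n)%N -> has_comeager_diag_class H n.

(* Main.v *)
Require Import Defs.
From mathcomp Require Import all_boot all_order all_algebra.
From mathcomp Require Import all_classical all_reals all_analysis.
From mathcomp Require Import lra.

(** Write [X] for [G^n], and let [a] be a point of [L_0(G)^n] with comeager orbit,
    seen as a measurable map [f] from the unit interval to [X]. The conclusion is
    reached by showing that almost every value [f t] has a comeager orbit in [X].

    Call a point [x] of [X] locally dense if, for every neighbourhood [V] of the
    identity, the closure of [V.x] is a neighbourhood of [x]. In the spirit of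
    Effros' theorem, a locally dense point with a dense orbit has a comeager
    orbit, for any continuous action of a Polish group
    ([locally_dense_comeager_orbit]): local density spreads to comeagerly many
    points ([comeager_locally_dense]), and each of these is joined to the given
    point, whose orbit is dense, by a back-and-forth construction that converges
    in the group ([locally_dense_same_orbit]).

    It remains to see that almost every [f t] is locally dense and has a dense
    orbit. The space [L_0(G)^n] is a Baire space, because convergence in measure
    is complete ([L0fun_complete], [comeager_L0_tuple_meets]), so the orbit of [a]
    meets every comeager set and every nonempty open set.

    For density of orbits, a member of the orbit of [a] is taken close to a
    constant function with value in a given basic open set
    ([generic_value_dense_orbit]). For local density, consider sets [M x] which
    depend on [x] in a lower semicontinuous way. Generic tuples [b] avoid the
    boundary of the closure of [M (f t)] at almost every [t]
    ([generic_interior_closure]), since off this boundary lies a dense open set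
    that varies measurably with [t] ([comeager_inside]). This is applied to
    [M x = (g_j V).x], with [g_j] running through a dense sequence of [G]: if
    [b = h.a] is a generic member of the orbit of [a], then [h t] lies in some
    [g_j V], so [b t] lies in [M (f t)], hence in the interior of its closure, and
    translating by the inverse of [h t] gives local density at [f t]
    ([generic_value_locally_dense]). *)

Set Implicit Arguments.
Unset Strict Implicit.
Unset Printing Implicit Defensive.

Import Order.TTheory GRing.Theory Num.Theory numFieldNormedType.Exports.

Local Open Scope classical_set_scope.
Local Open Scope ring_scope.

(** * Countable bases and comeager sets *)

Definition countable_basis (T : topologicalType) (B : nat -> set T) :=
  (forall m, open (B m)) /\
  (forall x U, nbhs x U -> exists2 m, B m x & B m `<=` U).

Lemma metric_countable_basis (R : realType) (T : topologicalType)
    (d : T -> T -> R) (x0 : T) :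
  is_metric d -> metrizes d -> separable T -> exists B, @countable_basis T B.
Proof.
move=> dm dt sT; have [s sd] := separable_dense_seq dm dt x0 sT.
have [d0 dC dD] := dm.
pose C (p : nat * nat) := [set y | d (s p.1) y < p.2.+1%:R^-1].
pose B m := if unpickle m is Some p then C p else set0.
exists B; split=> [m|x U /dt[e e0 eU]].
  by rewrite /B; case: unpickle => [p|]; [exact: metric_ball_open|exact: open0].
have e20 : 0 < e / 2 by rewrite divr_gt0.
have [k _ /(_ k)/(_ (leqnn _)) /= ke] := near_infty_natSinv_lt (PosNum e20).
have [n sna] := sd x k.+1%:R^-1 (ltac:(by [])).
exists (pickle (n, k)); rewrite /B pickleK// => y /= sny; apply: eU => /=.
rewrite (le_lt_trans (dD x (s n) y))// [e]splitr ltrD//.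
  by rewrite dC; apply: lt_trans ke.
exact: lt_trans ke.
Qed.

Lemma basis_dense_seq (T : topologicalType) (B : nat -> set T) (x0 : T) :
  countable_basis B ->
  exists z : nat -> T, forall U : set T, open U -> U !=set0 -> exists i, U (z i).
Proof.
move=> [oB bB].
have /choice[z zB] : forall m, exists z, B m !=set0 -> B m z.
  move=> m; have [[z Bz]|nB] := pselect (B m !=set0); first by exists z.
  by exists x0.
exists z => U oU [x Ux].
have [m Bx BU] := bB _ _ (open_nbhs_nbhs (conj oU Ux)).
by exists m; apply/BU/zB; exists x.
Qed.

(** Indexing by any countable type spares the explicit enumeration of nested
    countable intersections. *)
Lemma comeager_countable (T : topologicalType) (J : countType)
    (U : J -> set T) (A : set T) :
  (forall i, open (U i) /\ dense (U i)) -> \bigcap_i U i `<=` A -> comeager A.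
Proof.
move=> Uod UA; apply/comeagerP.
exists (fun m => if unpickle m is Some i then U i else setT).
  move=> m; case: unpickle => [i|]; first exact: Uod.
  split; [exact: openT|by move=> O O0 _; rewrite setIT].
by move=> x Ux; apply: UA => i _; have := Ux (pickle i) I; rewrite pickleK.
Qed.

Lemma comeager_bigcap (T : topologicalType) (J : countType) (A : J -> set T) :
  (forall j, comeager (A j)) -> comeager (\bigcap_j A j).
Proof.
move=> cA.
have /choice[U UP] : forall j, exists U : nat -> set T,
    (forall i, open (U i) /\ dense (U i)) /\ \bigcap_i U i `<=` A j.
  by move=> j; have /comeagerP[U ? ?] := cA j; exists U.
apply: (@comeager_countable _ _ (fun p : J * nat => U p.1 p.2)).
  by move=> [j i] /=; exact: (UP j).1.
by move=> x Ux j _; apply: (UP j).2 => i _; exact: (Ux (j, i)).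
Qed.

Lemma comeagerS (T : topologicalType) (A B : set T) :
  A `<=` B -> comeager A -> comeager B.
Proof.
move=> AB /comeagerP[U Uod UA]; apply/comeagerP; exists U => //.
exact: subset_trans UA AB.
Qed.

Lemma comeagerI (T : topologicalType) (A B : set T) :
  comeager A -> comeager B -> comeager (A `&` B).
Proof.
move=> cA cB.
apply: comeagerS (@comeager_bigcap _ _ (fun b : bool => if b then A else B) _).
  by move=> x ABx; split; [exact: (ABx true)|exact: (ABx false)].
by case.
Qed.

(** * Fast Cauchy sequences in a metric space *)

Section fast_sequences.
Context {R : realType} {T : topologicalType} (d : T -> T -> R).
Hypothesis dm : is_metric d.
Context (s : nat -> R).
Hypotheses (s0 : forall k, 0 < s k) (sS : forall k, s k.+1 <= s k / 2).

Lemma geometric_sum_le k j :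
  \sum_(k <= i < k + j) s i <= 2 * s k - 2 * s (k + j)%N.
Proof.
elim: j => [|j IH]; first by rewrite addn0 big_geq// subrr.
rewrite addnS big_nat_recr ?leq_addr//=.
apply: (le_trans (lerD IH (lexx _))).
by have := sS (k + j); lra.
Qed.

Lemma fast_anti i j : (i <= j)%N -> s j <= s i.
Proof.
move=> /subnKC <-; elim: (j - i)%N => [|m IH]; first by rewrite addn0.
rewrite addnS; apply: le_trans IH; apply: (le_trans (sS _)).
by rewrite ler_pdivrMr// ler_peMr ?ltW// ltr1n.
Qed.

Lemma fast_small e : 0 < e -> exists k, s k < e.
Proof.
move=> e0; have es0 : 0 < e / s 0%N by rewrite divr_gt0.
have [k _ /(_ k)/(_ (leqnn _)) /= ke] := near_infty_natSinv_lt (PosNum es0).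
exists k.
have sk : s k * 2 ^+ k <= s 0%N.
  elim: {ke} k => [|k IH]; first by rewrite mulr1.
  apply: le_trans IH; rewrite exprS mulrA ler_wpM2r ?exprn_ge0//.
  by rewrite -ler_pdivlMr.
have kk : k.+1%:R <= 2 ^+ k :> R by rewrite -natrX ler_nat ltn_expl.
rewrite -(@ltr_pM2r _ (2 ^+ k)) ?exprn_gt0//; apply: (le_lt_trans sk).
rewrite ltr_pdivlMr// in ke.
have k0 : 0 < k.+1%:R :> R by rewrite ltr0n.
rewrite ltr_pdivrMl// mulrC in ke.
by apply: (lt_le_trans ke); rewrite ler_wpM2l// ltW.
Qed.

Context (u : nat -> T) (k : nat).
Hypothesis us : forall i, (k <= i)%N -> d (u i) (u i.+1) <= s i.

Lemma fast_dist_le i j : (k <= i)%N -> d (u i) (u (i + j)%N) <= 2 * s i.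
Proof.
have [d0 dC dD] := dm.
move=> ki; apply: (@le_trans _ _ (2 * s i - 2 * s (i + j)%N)); last first.
  by rewrite gerBl; apply: mulr_ge0 => //; exact: ltW.
apply: le_trans (geometric_sum_le i j); elim: j => [|j IH].
  by rewrite addn0 big_geq// (d0 _ _).2.
rewrite addnS big_nat_recr ?leq_addr//=.
apply: (le_trans (dD _ (u (i + j)%N) _)); apply: lerD => //.
by apply: us; apply: (leq_trans ki); exact: leq_addr.
Qed.

Lemma fast_cvg : metric_complete d -> exists l : T, u @ \oo --> l.
Proof.
have [d0 dC dD] := dm.
apply=> e e0; have e40 : 0 < e / 4 by rewrite divr_gt0.
have [N Ne] := fast_small e40.
exists (maxn k N) => p q kp kq.
have sm : 2 * s (maxn k N) < e / 2 by have := fast_anti (leq_maxr k N); lra.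
have := fast_dist_le (p - maxn k N) (leq_maxl k N).
have := fast_dist_le (q - maxn k N) (leq_maxl k N).
rewrite !subnKC// => dq; rewrite dC => dp.
by apply: (le_lt_trans (dD _ (u (maxn k N)) _)); lra.
Qed.

End fast_sequences.

(** * Finite powers of a space *)

Section finite_product.
Context (n : nat) (T : topologicalType).
Implicit Types (x y : {ptws 'I_n -> T}) (A : set {ptws 'I_n -> T}).

Lemma nbhs_ptwsP x A : nbhs x A <->
  exists2 P : 'I_n -> set T, (forall i, nbhs (x i) (P i)) &
    [set y | forall i, P i (y i)] `<=` A.
Proof.
split; last first.
  move=> [P xP PA]; apply: (@filterS _ _ (nbhs_filter x) _ _ PA).
  apply: (@filter_forall _ _ (fun i (y : {ptws 'I_n -> T}) => P i (y i)) _
    (nbhs_filter x)) => i.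
  exact: (@proj_continuous _ (fun=> T) i x (P i) (xP i)).
pose F := filter_from (fun P : 'I_n -> set T => forall i, nbhs (x i) (P i))
  (fun P => [set y : {ptws 'I_n -> T} | forall i, P i (y i)]).
have FF : Filter F.
  apply: filter_from_filter; first by exists (fun=> setT) => i; exact: filterT.
  move=> P Q xP xQ; exists (fun i => P i `&` Q i).
    by move=> i; exact: filterI.
  by move=> y PQy; split=> i; case: (PQy i).
(* The product topology is a supremum of initial topologies, so this only has
   to be checked one coordinate at a time. *)
have Fx : F --> x.
  apply/cvg_sup => i B; rewrite nbhsE => -[_ [[W oW <-] Wx] WB].
  exists (fun j => if j == i then W else setT).
    move=> j; case: eqVneq => [->|_]; last exact: filterT.
    exact: open_nbhs_nbhs.
  by move=> y /(_ i); rewrite eqxx => Wy; apply: WB.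
by move=> /Fx[P xP PA]; exists P.
Qed.

Lemma ptws_countable_basis (B : nat -> set T) :
  countable_basis B ->
  exists C : nat -> set {ptws 'I_n -> T}, countable_basis C.
Proof.
move=> [oB bB].
pose D (c : {ffun 'I_n -> nat}) : set {ptws 'I_n -> T} :=
  [set y | forall i, B (c i) (y i)].
have oD c : open (D c).
  rewrite openE => y Dy; apply/nbhs_ptwsP; exists (fun i => B (c i)) => // i.
  exact: open_nbhs_nbhs.
exists (fun m => if unpickle m is Some c then D c else set0); split.
  by move=> m; case: unpickle => [c|]; [exact: oD|exact: open0].
move=> x U /nbhs_ptwsP[P xP PU].
have /choice[c cP] : forall i, exists m, B m (x i) /\ B m `<=` P i.
  by move=> i; have [m ? ?] := bB _ _ (xP i); exists m.
exists (pickle [ffun i => c i]); rewrite pickleK /D/=.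
  by move=> i; rewrite ffunE; case: (cP i).
by move=> y Dy; apply: PU => i; have := Dy i; rewrite ffunE; apply: (cP i).2.
Qed.

Lemma cvg_ptws (u : nat -> {ptws 'I_n -> T}) x :
  (forall i, u^~ i @ \oo --> x i) -> u @ \oo --> x.
Proof.
move=> ux A /nbhs_ptwsP[P xP PA].
apply: (@filterS _ (u @ \oo) _ _ _ PA).
apply: (@filter_forall _ _ (fun i (y : {ptws 'I_n -> T}) => P i (y i))
  (u @ \oo) _) => i.
exact: (ux i _ (xP i)).
Qed.

Section max_metric.
Context {R : realType} (d : T -> T -> R).
Hypotheses (dm : is_metric d) (dt : metrizes d).

Definition max_dist x y : R := \big[Num.max/0]_(i < n) d (x i) (y i).

Lemma metric_ge0 a b : 0 <= d a b.
Proof.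
have [d0 dC dD] := dm; have := dD a b a; rewrite [d b a]dC.
by rewrite (d0 a a).2// -mulr2n pmulrn_lge0.
Qed.

Lemma max_dist_ltP x y r : 0 < r ->
  max_dist x y < r <-> forall i, d (x i) (y i) < r.
Proof.
move=> r0; split=> [/bigmax_ltP[_ xy] i|xy]; first exact: xy.
by apply/bigmax_ltP; split=> // i _.
Qed.

Lemma le_max_dist x y i : d (x i) (y i) <= max_dist x y.
Proof. exact: (le_bigmax _ (fun i => d (x i) (y i))). Qed.

Lemma max_dist_ge0 x y : 0 <= max_dist x y.
Proof. exact: bigmax_ge_id. Qed.

Lemma max_dist_metric : is_metric max_dist.
Proof.
have [d0 dC dD] := dm; split.
- move=> x y; split=> [xy0|->].
    apply/funext => i; apply/d0/eqP; rewrite eq_le metric_ge0 andbT.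
    by rewrite -xy0; exact: le_max_dist.
  apply/eqP; rewrite eq_le max_dist_ge0 andbT; apply/bigmax_leP; split=> // i _.
  by rewrite (d0 _ _).2.
- by move=> x y; apply: eq_bigr => i _.
- move=> x y z; apply/bigmax_leP; split=> [|i _].
    by apply: addr_ge0; exact: max_dist_ge0.
  by apply: (le_trans (dD _ (y i) _)); apply: lerD; exact: le_max_dist.
Qed.

Lemma max_dist_metrizes : metrizes max_dist.
Proof.
move=> x A; split=> [/nbhs_ptwsP[P xP PA]|[e e0 eA]]; last first.
  apply/nbhs_ptwsP; exists (fun i => [set b | d (x i) b < e]).
    by move=> i; exact: metric_ball_nbhs.
  by move=> y xy; apply: eA => /=; exact/max_dist_ltP.
have /choice[e eP] : forall i, exists e, 0 < e /\ [set b | d (x i) b < e] `<=` P i.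
  by move=> i; have /dt[e ? ?] := xP i; exists e.
exists (\big[Num.min/1]_(i < n) e i).
  by apply: lt_bigmin => // i _; case: (eP i).
move=> y xy; apply: PA => i; apply: (eP i).2 => /=.
apply: (le_lt_trans (le_max_dist x y i)).
by apply: (lt_le_trans xy); exact: bigmin_le.
Qed.

Lemma max_dist_complete : metric_complete d -> metric_complete max_dist.
Proof.
move=> dc u cu.
have ex_lim i : exists l : T, (fun k => u k i) @ \oo --> l.
  apply: dc => e e0; have [N NP] := cu e e0.
  exists N => p q Np Nq; apply: le_lt_trans (NP p q Np Nq).
  exact: le_max_dist.
have [l ul] := choice ex_lim.
by exists l; exact: cvg_ptws.
Qed.

End max_metric.
End finite_product.

(** * Locally dense points of a continuous group action *)

Section translations.
Context {H : topologicalGroupType}.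

Lemma mulgl_continuous (x : H) : continuous (fun z => x * z)%g.
Proof.
move=> y; apply: (@continuous2_cvg _ _ _ _ _ _
  (fun=> x) id (fun s t => s * t)%g).
- exact: (@mulg_continuous H (x, y)).
- exact: cvg_cst.
- exact: cvg_id.
Qed.

Lemma mulgr_continuous (y : H) : continuous (fun z => z * y)%g.
Proof.
move=> x; apply: (@continuous2_cvg _ _ _ _ _ _
  id (fun=> y) (fun s t => s * t)%g).
- exact: (@mulg_continuous H (x, y)).
- exact: cvg_id.
- exact: cvg_cst.
Qed.

End translations.

Section continuous_action.
Context {H : topologicalGroupType} {X : topologicalType} (act : H -> X -> X).
Hypotheses (act1 : forall x, act 1%g x = x)
  (actM : forall g h x, act (g * h)%g x = act g (act h x))
  (act_contr : forall g, continuous (act g))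
  (act_contl : forall x, continuous (act^~ x)).

(** The orbit map at [x] is open up to closure, near the identity: an
    approximate form of the conclusion of Effros' theorem. *)
Definition locally_dense x :=
  forall V : set H, nbhs 1%g V -> nbhs x (closure (act^~ x @` V)).

Let actK g x : act g^-1%g (act g x) = x.
Proof. by rewrite -actM mulVg act1. Qed.

Let actVK g x : act g (act g^-1%g x) = x.
Proof. by rewrite -actM mulgV act1. Qed.

Lemma nbhs_closure_act g x (A : set X) :
  nbhs x (closure A) -> nbhs (act g x) (closure (act g @` A)).
Proof.
move=> xA; have : nbhs (act g x) (act g^-1%g @^-1` closure A).
  by apply: act_contr; rewrite actK.
apply: filterS => y /= Ay N yN.
have /Ay[z [Az Nz]] : nbhs (act g^-1%g y) (act g @^-1` N).
  by apply: act_contr; rewrite actVK.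
by exists (act g z); split=> //; exists z.
Qed.

Lemma locally_dense_act g x : locally_dense x -> locally_dense (act g x).
Proof.
move=> ldx V V1.
have V'1 : nbhs 1%g [set v | V (g * v * g^-1)%g].
  have : nbhs (g * 1 * g^-1)%g V by rewrite mulg1 mulgV.
  by move=> /(@mulgr_continuous H g^-1%g (g * 1)%g)/(@mulgl_continuous H g 1%g).
apply: (filterS _ (nbhs_closure_act g (ldx _ V'1))); apply: closureS.
move=> _ [_ [v Vv <-] <-]; exists (g * v * g^-1)%g => //.
by rewrite !actM actK.
Qed.

(** A point [y] that meets enough dense open sets inherits local density from
    [x]: near [y] the local orbit of some [g x] is dense, and if the local orbit
    of [y] missed an open set there, so would, up to boundary, those of points of
    this dense set, although they can be moved there by a small element. *)
Lemma comeager_locally_dense (C : nat -> set X) (V : nat -> set H) x :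
  countable_basis C -> (forall k, nbhs 1%g (V k)) ->
  (forall N : set H, nbhs 1%g N -> exists k, V k `<=` N) ->
  locally_dense x -> dense (range (act^~ x)) -> comeager locally_dense.
Proof.
move=> [oC bC] V1 VN ldx dx.
have /choice[W WP] : forall k, exists W : set H, nbhs 1%g W /\
    forall w w', W w -> W w' -> V k (w' * w^-1)%g.
  move=> k; have : nbhs ((1%g : H) * 1^-1)%g (V k) by rewrite invg1 mulg1.
  case/(@mulg_continuous H (1%g, 1^-1%g)) => -[P Q] /= [P1 /invg_continuous Q1] PQ.
  exists (P `&` (fun x => x^-1)%g @^-1` Q); split; first exact: filterI.
  by move=> w w' [_ Qw] [Pw' _]; exact: (PQ (w', w^-1%g)).
pose A k i := \bigcup_(v in V k) act v @^-1` C i.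
have oA k i : open (A k i).
  apply: bigcup_open => v _; apply: open_comp => // y _; exact: act_contr.
(* Meeting [P k] places [y] where some local orbit is dense; meeting the sets
   [A k i `|` ~` closure (A k i)] removes the boundaries of the [A k i]. *)
pose P k := \bigcup_g (closure (act^~ (act g x) @` W k))°.
pose U (j : nat * option nat) :=
  if j.2 is Some i then A j.1 i `|` ~` closure (A j.1 i) else P j.1.
apply: (@comeager_countable _ _ U).
  move=> [k [i|]]; rewrite /U /=; split.
  - apply: openU => //; exact/closed_openC/closed_closure.
  - move=> O [y Oy] oO; have [clA|ncl] := pselect (closure (A k i) y).
      have [z [Az Oz]] := clA _ (open_nbhs_nbhs (conj oO Oy)).
      by exists z; split=> //; left.
    by exists y; split=> //; right.
  - by apply: bigcup_open => g _; exact: open_interior.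
  - move=> O O0 oO; have [y [Oy [g _ gxy]]] := dx O O0 oO.
    exists y; split=> //; exists g => //; rewrite -gxy.
    by apply: locally_dense_act => //; case: (WP k).
move=> y Uy N /VN[k kN].
have [g _ Oy] := Uy (k, None) I.
set O := (closure _)° in Oy; have oO : open O by exact: open_interior.
apply: filterS (open_nbhs_nbhs (conj oO Oy)) => z Oz M zM.
have [i Ciz CiM] : exists2 i, C i z & C i `<=` M `&` O.
  by apply: bC; apply: filterI => //; exact: open_nbhs_nbhs.
have [[v Vv Cvy]|nA] := Uy (k, Some i) I.
  by exists (act v y); split; [exists v => //; exact: kN|case: (CiM _ Cvy)].
exfalso.
(* A local orbit dense around [y] has a point off [closure (A k i)] and a point
   in [C i]; the small element between them puts the former in [A k i]. *)
have oE : open (O `&` ~` closure (A k i)).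
  by apply: openI => //; exact/closed_openC/closed_closure.
have [_ [[w Ww <-] [_ nAw]]] :
    (act^~ (act g x) @` W k) `&` (O `&` ~` closure (A k i)) !=set0.
  exact: (interior_subset Oy _ (open_nbhs_nbhs (conj oE (conj Oy nA)))).
have [_ [[w' Ww' <-] Ciw']] : (act^~ (act g x) @` W k) `&` C i !=set0.
  by apply: (interior_subset Oz); exact: (open_nbhs_nbhs (conj (oC i) Ciz)).
apply: nAw; apply: subset_closure; exists (w' * w^-1)%g.
  exact: (WP k).2.
by rewrite /= actM actK.
Qed.

Section back_and_forth.
Context {R : realType} (d : H -> H -> R) (e : X -> X -> R).
Hypotheses (dm : is_metric d) (dt : metrizes d) (dc : metric_complete d).
Hypotheses (em : is_metric e) (et : metrizes e).

Let ball g r x := act^~ x @` [set g' | d g g' < r].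

Let nbhs_ball g r x : 0 < r -> locally_dense x ->
  nbhs (act g x) (closure (ball g r x)).
Proof.
move=> r0 ldx.
have V1 : nbhs 1%g [set v | d g (g * v)%g < r].
  have : nbhs (g * 1)%g [set v | d g v < r].
    by rewrite mulg1; exact: metric_ball_nbhs.
  by move=> /(@mulgl_continuous H g 1%g).
apply: (filterS _ (nbhs_closure_act g (ldx _ V1))); apply: closureS.
by move=> _ [_ [v /= gv <-] <-]; exists (g * v)%g => //; rewrite actM.
Qed.

Let step x y r g h r' : locally_dense x -> closure (ball h r y) (act g x) ->
  0 < r' -> exists h', [/\ d h h' < r, e (act g x) (act h' y) < r' &
    closure (ball g r' x) (act h' y)].
Proof.
move=> ldx gx r'0.
have /nbhs_interior/nbhs_singleton Nx := nbhs_ball g r'0 ldx.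
have /gx[_ [[h' hh' <-] [/= /interior_subset ? ?]]] : nbhs (act g x)
    ((closure (ball g r' x))° `&` [set z | e (act g x) z < r']).
  apply: filterI; last exact: metric_ball_nbhs.
  exact: open_nbhs_nbhs (conj (open_interior _) Nx).
by exists h'.
Qed.

(** Alternately moving [x] and [y] by ever smaller group elements keeps each in
    the closure of the other's local orbit; completeness makes the two products
    converge, to elements that send [x] and [y] to the same point. *)
Lemma locally_dense_same_orbit x y : locally_dense x -> locally_dense y ->
  dense (range (act^~ x)) -> range (act^~ x) y.
Proof.
move=> ldx ldy dx.
have [d0 dC dD] := dm; have [e0 eC eD] := em.
pose r k : R := 2^-1 ^+ k.
have r0 k : 0 < r k by rewrite exprn_gt0// invr_gt0.
have rS k : r k.+1 = r k / 2 by rewrite /r exprSr.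
(* The invariant: a push of size [r k] on [p.2] can bring [act p.2 y] as close
   as desired to [act p.1 x]. *)
pose ok k (p : H * H) := closure (ball p.2 (r k) y) (act p.1 x).
have [p0 ok0] : exists p, ok 0%N p.
  have /nbhs_interior/nbhs_singleton Ny := nbhs_ball 1%g (r0 0%N) ldy.
  rewrite act1 in Ny.
  have [z [Nz [g _ gz]]] := dx _ (ex_intro _ _ Ny) (open_interior _).
  by exists (g, 1%g); rewrite /ok /= gz; exact: interior_subset Nz.
have next_ex (kp : nat * (H * H)) : exists q : H * H, ok kp.1 kp.2 ->
    [/\ ok kp.1.+1 q, d kp.2.1 q.1 < r kp.1, d kp.2.2 q.2 < r kp.1 &
        e (act kp.2.1 x) (act q.2 y) < r kp.1].
  case: kp => k [g h] /=.
  have [gh|] := pselect (ok k (g, h)); last by exists (g, h).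
  have [h' [hh' ee gh']] := step ldx gh (r0 k).
  have [g' [gg' _ h'g']] := step ldy gh' (r0 k.+1).
  by exists (g', h').
have [next nextP] := choice next_ex.
pose p := fix p k := if k is k'.+1 then next (k', p k') else p0.
have okp k : ok k (p k) by elim: k => [//|k IH]; case: (nextP (k, p k) IH).
have pP k := nextP (k, p k) (okp k).
have rS' k : r k.+1 <= r k / 2 by rewrite rS.
have [g pg] : exists g : H, (fun k => (p k).1) @ \oo --> g.
  apply: (fast_cvg dm r0 rS' (k := 0%N)) => // k _; apply: ltW.
  by case: (pP k).
have [h ph] : exists h : H, (fun k => (p k).2) @ \oo --> h.
  apply: (fast_cvg dm r0 rS' (k := 0%N)) => // k _; apply: ltW.
  by case: (pP k).
suff gh : act g x = act h y.
  by exists (h^-1 * g)%g => //; rewrite actM gh actK.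
apply/e0/eqP; rewrite eq_le (metric_ge0 em) andbT; apply/ler_addgt0Pr => z z0.
have z40 : 0 < z / 4 by rewrite divr_gt0.
have [K Kz] := fast_small r0 rS' z40.
have [M _ Mg] := pg _ (act_contl (metric_ball_nbhs et (act g x) z40)).
have [N _ Nh] := ph _ (act_contl (metric_ball_nbhs et (act h y) z40)).
pose m := maxn K (maxn M N).
have gx : e (act g x) (act (p m).1 x) < z / 4.
  by apply: Mg; rewrite /= /m leq_max leq_maxl orbT.
have hy : e (act h y) (act (p m.+1).2 y) < z / 4.
  by apply: Nh; rewrite /= leqW// /m leq_max leq_maxr orbT.
have [_ _ _ gh] := pP m.
have rm : r m <= r K by apply: (fast_anti r0 rS'); rewrite leq_maxl.
rewrite add0r.
apply: (le_trans (eD _ (act (p m).1 x) _)).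
apply: (le_trans (lerD (lexx _) (eD _ (act (p m.+1).2 y) _))).
by rewrite [e _ (act h y)]eC; move: gh => /=; lra.
Qed.

Lemma locally_dense_comeager_orbit (C : nat -> set X) x : countable_basis C ->
  locally_dense x -> dense (range (act^~ x)) -> comeager (range (act^~ x)).
Proof.
move=> bC ldx dx.
apply: (@comeagerS _ locally_dense).
  by move=> y ldy; exact: locally_dense_same_orbit.
apply: (comeager_locally_dense
  (V := fun k => [set v | d 1%g v < k.+1%:R^-1])) bC _ _ ldx dx.
  by move=> k; exact: metric_ball_nbhs.
move=> N /dt[z z0 zN].
have [k _ /(_ k)/(_ (leqnn _)) /= kz] := near_infty_natSinv_lt (PosNum z0).
by exists k => v /= v1; apply: zN; exact: lt_trans kz.
Qed.

End back_and_forth.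
End continuous_action.

Section diagonal_action.
Context {H : topologicalGroupType} (n : nat).
Local Notation X := {ptws 'I_n -> H}.

Lemma diag_conj1 (x : X) : diag_conj 1%g x = x.
Proof. by apply/funext => i; rewrite /diag_conj mul1g invg1 mulg1. Qed.

Lemma diag_conjM (g h : H) (x : X) :
  diag_conj (g * h)%g x = diag_conj g (diag_conj h x).
Proof. by apply/funext => i; rewrite /diag_conj invgM !mulgA. Qed.

Lemma diag_conj_continuousr (g : H) : continuous (diag_conj g : X -> X).
Proof.
move=> x A /nbhs_ptwsP[P xP PA]; apply/nbhs_ptwsP.
exists (fun i => [set y | P i (g * y * g^-1)%g]); last first.
  by move=> y yP; exact: PA.
move=> i; suff : {for x i, continuous (fun y => g * y * g^-1)%g}.
  by apply; exact: xP.
apply: (@continuous_comp _ _ _ (fun y => g * y)%g (fun y => y * g^-1)%g).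
  exact: mulgl_continuous.
exact: mulgr_continuous.
Qed.

Lemma diag_conj_continuousl (x : X) : continuous (fun g : H => diag_conj g x).
Proof.
move=> g A /nbhs_ptwsP[P xP PA].
apply: (@filterS _ _ (nbhs_filter g)
  [set h : H | forall i, P i (h * x i * h^-1)%g]).
  by move=> h hP; exact: PA.
apply: (@filter_forall _ _ (fun i h => P i (h * x i * h^-1)%g)
  _ (nbhs_filter g)) => i.
suff : {for g, continuous (fun z => z * x i * z^-1)%g} by apply; exact: xP.
apply: (@continuous2_cvg _ _ _ _ _ _
  (fun z => z * x i)%g (fun z => z^-1)%g (fun s t => s * t)%g).
- exact: (@mulg_continuous H (g * x i, g^-1)%g).
- exact: mulgr_continuous.
- exact: invg_continuous.
Qed.

End diagonal_action.

(** * Measurable functions on the unit interval *)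

Section measure_on_unit_interval.
Context {R : realType}.
Local Notation mu := (@completed_lebesgue_measure R).
Implicit Types A B : set (lebesgueR R).

Lemma le_mu A B : measurable A -> measurable B -> A `<=` B -> (mu A <= mu B)%E.
Proof. by move=> mA mB AB; apply: le_measure; rewrite ?inE. Qed.

Lemma le_mu_ae A B : measurable A -> measurable B ->
  {ae mu, forall t, A t -> B t} -> (mu A <= mu B)%E.
Proof.
move=> mA mB [N [mN N0 NAB]].
apply: (@le_trans _ _ (mu (B `|` N))%E).
  apply: le_mu => //; first exact: measurableU.
  move=> t At; have [Nt|nNt] := pselect (N t); [by right|left].
  by apply: contrapT => nBt; apply: nNt; apply: NAB => /= /(_ At).
by rewrite -[leRHS]adde0 -[in leRHS]N0; exact: measureU2.
Qed.

Lemma le_muU A B : measurable A -> measurable B ->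
  (mu (A `|` B) <= mu A + mu B)%E.
Proof. by move=> mA mB; exact: measureU2. Qed.

Lemma ae_countable (J : countType) (P : J -> lebesgueR R -> Prop) :
  (forall j, {ae mu, forall t, P j t}) -> {ae mu, forall t, forall j, P j t}.
Proof.
move=> aP.
have : {ae mu, forall t, forall m, if unpickle m is Some j then P j t else True}.
  apply: ae_foralln => m; case: unpickle => [j|]; first exact: aP.
  exact: aeW.
by apply: filterS => t Pt j; have := Pt (pickle j); rewrite pickleK.
Qed.

Lemma mu_shrinking (E : nat -> set (lebesgueR R)) (e : R) :
  (forall k, measurable (E k)) -> (forall k, E k `<=` I01) ->
  (forall k m, (k <= m)%N -> E m `<=` E k) ->
  (forall t, exists k, ~ E k t) -> 0 < e ->
  exists k, (mu (E k) < e%:E)%E.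
Proof.
move=> mE EI Ed E0 e0.
have Ecap : \bigcap_k E k = set0.
  by apply/seteqP; split=> // t Et; have [k] := E0 t; apply; exact: Et.
have : mu (E k) @[k --> \oo] --> mu (\bigcap_k E k).
  apply: nonincreasing_cvg_mu => //.
  - apply: (@le_lt_trans _ _ (mu I01)); last by rewrite mu_I01 ltry.
    by apply: le_mu => //; exact: measurable_I01.
  - by rewrite Ecap.
  - by move=> k m km; apply/subsetPset; exact: Ed.
rewrite Ecap measure0 => Ecvg.
have : nbhs (0%E : \bar R) [set x | (x < e%:E)%E].
  by apply: open_nbhs_nbhs; split; [exact: open_ereal_lt_ereal|rewrite /= lte_fin].
by move=> /Ecvg[k _ /(_ k (leqnn _))]; exists k.
Qed.

End measure_on_unit_interval.

Section measurable_functions.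
Context {R : realType} {T : topologicalType}.
Local Notation mu := (@completed_lebesgue_measure R).
Implicit Types f g h : L0fun R T.

Lemma preimage_closed_measurable f (C : set T) : open (~` C) ->
  measurable (I01 `&` f @^-1` C).
Proof.
move=> oC; rewrite (_ : _ `&` _ = I01 `\` (I01 `&` f @^-1` (~` C))).
  by apply: measurableD; [exact: measurable_I01|exact: L0fun_measurable].
apply/seteqP; split=> t [It Ct]; split=> //; first by case.
by apply: contrapT => nCt; apply: Ct.
Qed.

Lemma I01_setC_measurable (A : set (lebesgueR R)) :
  measurable (I01 `&` A) -> measurable (I01 `&` ~` A).
Proof.
move=> mA; rewrite (_ : _ `&` _ = I01 `\` (I01 `&` A)).
  by apply: measurableD => //; exact: measurable_I01.
by apply/seteqP; split=> t [It At]; split=> //; [case|move=> At'; exact: At].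
Qed.

Lemma countable_union_measurable (J : countType) (E : J -> set (lebesgueR R)) :
  (forall j, measurable (I01 `&` E j)) ->
  measurable (I01 `&` [set t | exists j, E j t]).
Proof.
move=> mE; rewrite (_ : _ `&` _ = \bigcup_j (I01 `&` E j)).
  by apply: countable_bigcupT_measurable => //; exact: countableP.
apply/seteqP; split=> t; first by move=> [It [j Ej]]; exists j.
by move=> [j _ [It Ej]]; split=> //; exists j.
Qed.

Lemma countable_inter_measurable (J : countType) (E : J -> set (lebesgueR R)) :
  (forall j, measurable (I01 `&` E j)) ->
  measurable (I01 `&` [set t | forall j, E j t]).
Proof.
move=> mE; rewrite (_ : _ `&` _ = I01 `&` ~` [set t | exists j, ~ E j t]).
  apply/I01_setC_measurable/countable_union_measurable => j.
  exact: I01_setC_measurable.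
apply/seteqP; split=> t [It Et]; split=> //; first by case=> j; apply.
by move=> j; apply: contrapT => nE; apply: Et; exists j.
Qed.

Lemma prop_measurable (P : Prop) (A : set (lebesgueR R)) :
  measurable (I01 `&` A) -> measurable (I01 `&` [set t | P /\ A t]).
Proof.
move=> mA; have [p|np] := pselect P.
  rewrite (_ : _ `&` _ = I01 `&` A)//.
  by apply/seteqP; split=> t [It]; [case|].
rewrite (_ : _ `&` _ = set0); first exact: measurable0.
by apply/seteqP; split=> t // [? []].
Qed.

Lemma I01_setI_measurable (A B : set (lebesgueR R)) :
  measurable (I01 `&` A) -> measurable (I01 `&` B) ->
  measurable (I01 `&` [set t | A t /\ B t]).
Proof.
move=> mA mB; rewrite (_ : _ `&` _ = (I01 `&` A) `&` (I01 `&` B)).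
  exact: measurableI.
by apply/seteqP; split=> [t [? []]|t [[? ?] []]].
Qed.

Lemma I01_setU_measurable (A B : set (lebesgueR R)) :
  measurable (I01 `&` A) -> measurable (I01 `&` B) ->
  measurable (I01 `&` [set t | A t \/ B t]).
Proof.
move=> mA mB; rewrite (_ : _ `&` _ = (I01 `&` A) `|` (I01 `&` B)).
  exact: measurableU.
apply/seteqP; split=> t; first by move=> [It [?|?]]; [left|right].
by move=> [] [It ?]; split=> //; [left|right].
Qed.

(** An open set of pairs is a countable union of products of basic open sets. *)
Lemma pair_measurable (B : nat -> set T) f g (S : set (T * T)) :
  countable_basis B -> open S ->
  measurable (I01 `&` [set t | S (f t, g t)]).
Proof.
move=> [oB bB] oS.
rewrite (_ : [set t | _] = [set t | exists p : nat * nat,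
    (forall y, B p.1 y.1 -> B p.2 y.2 -> S y) /\ (B p.1 (f t) /\ B p.2 (g t))]).
  apply: countable_union_measurable => p; apply: prop_measurable.
  by apply: I01_setI_measurable; exact: L0fun_measurable.
apply/seteqP; split=> [t /= St|t [p [pS [pf pg]]]]; last exact: pS.
have [[P Q] /= [/bB[i Bi iP] /bB[j Bj jQ]] PQ] := open_nbhs_nbhs (conj oS St).
by exists (i, j); split=> // y yi yj; apply: PQ; split; [exact: iP|exact: jQ].
Qed.

(** Measurable selection from a sequence of points: [g t] is the first [z i]
    that is admissible at [t]. *)
Lemma countable_choice_measurable (z : nat -> T) (E : nat -> set (lebesgueR R)) :
  (forall i, measurable (I01 `&` E i)) ->
  (forall t, I01 t -> exists i, E i t) ->
  exists g : L0fun R T, forall t, I01 t -> exists2 i, E i t & g t = z i.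
Proof.
move=> mE cE.
have /choice[k kP] : forall t, exists k, I01 t ->
    E k t /\ forall i, (i < k)%N -> ~ E i t.
  move=> t; have [It|] := pselect (I01 t); last by exists 0%N.
  have ex : exists i, `[< E i t >] by have [i Ei] := cE t It; exists i; apply/asboolP.
  exists (ex_minn ex) => _; case: ex_minnP => m /asboolP Em mmin; split=> // i im.
  by move=> /asboolP/mmin; rewrite leqNgt im.
have gm : lebesgue_measurable_fun (z \o k).
  move=> U oU; rewrite (_ : _ `&` _ = I01 `&` [set t | exists i,
      z i \in U /\ (E i t /\ (forall j : 'I_i, ~ E j t))]).
    apply: countable_union_measurable => i; apply: prop_measurable.
    apply: I01_setI_measurable => //; apply: countable_inter_measurable => j.
    exact: I01_setC_measurable.
  apply/seteqP; split=> t [It Ut]; split=> //.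
    exists (k t); split; [exact: mem_set|split; first exact: (kP t It).1].
    by move=> j; apply: (kP t It).2.
  case: Ut => i [/set_mem Ui [Ei Ej]] /=; suff -> : k t = i by [].
  have [Ek kmin] := kP t It; case: (ltngtP (k t) i) => // ki.
    by have := Ej (Ordinal ki).
  by have := kmin _ ki.
by exists (MkL0fun gm) => t It; exists (k t) => //; case: (kP t It).
Qed.

Section convergence_in_measure.
Context (d : T -> T -> R) (B : nat -> set T).
Hypotheses (dm : is_metric d) (dt : metrizes d) (bB : countable_basis B).

Lemma dist_lt_open r : open [set p : T * T | d p.1 p.2 < r].
Proof.
have [d0 dC dD] := dm.
rewrite openE => -[x y] /= xy.
have e0 : 0 < (r - d x y) / 2 by rewrite divr_gt0// subr_gt0.
exists ([set u | d x u < (r - d x y) / 2], [set u | d y u < (r - d x y) / 2]).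
  by split; exact: metric_ball_nbhs.
move=> [u v] /= [xu yv].
apply: (le_lt_trans (dD u x v)); rewrite [d u x]dC.
apply: (le_lt_trans (lerD (lexx _) (dD x y v))).
rewrite addrCA -ltrBrDl; apply: (lt_le_trans (ltrD xu yv)).
by rewrite -splitr.
Qed.

Definition far r f g : set (lebesgueR R) := I01 `&` [set t | r <= d (f t) (g t)].

Lemma far_measurable r f g : measurable (far r f g).
Proof.
rewrite /far (_ : [set t | _] = ~` [set t | d (f t) (g t) < r]).
  apply: I01_setC_measurable.
  exact: (@pair_measurable B f g
    [set p : T * T | d p.1 p.2 < r] bB (@dist_lt_open r)).
by apply/seteqP; split=> t /=; rewrite leNgt => /negP.
Qed.

(** Using one number both for the distance and for the measure gives a
    one-parameter base of the topology of convergence in measure. *)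
Definition near r f g := (mu (far r f g) < r%:E)%E.

Lemma far_sub r s f g : s <= r -> far r f g `<=` far s f g.
Proof. by move=> sr t [It rt]; split=> //=; exact: le_trans rt. Qed.

(** Belonging to an open set by a margin is stable under small changes of a
    function and under limits; that the condition is closed keeps it measurable. *)
Definition shrink r (U : set T) : set T := [set y | forall z, d y z < r -> U z].

Lemma shrink_closed r U : open (~` shrink r U).
Proof.
rewrite (_ : ~` _ = \bigcup_(z in ~` U) [set y | d z y < r]).
  by apply: bigcup_open => z _; exact: metric_ball_open.
have [_ dC _] := dm.
apply/seteqP; split=> [y /existsNP[z /not_implyP[yz nU]]|y [z nU zy] /(_ z)].
  by exists z => //=; rewrite dC.
by rewrite dC => /(_ zy).
Qed.

End convergence_in_measure.
End measurable_functions.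

(** * Completeness in measure *)

Section completeness_in_measure.
Context {R : realType} {T : topologicalType} (d : T -> T -> R) (B : nat -> set T).
Hypotheses (dm : is_metric d) (dt : metrizes d) (bB : countable_basis B).
Hypothesis dc : metric_complete d.
Local Notation mu := (@completed_lebesgue_measure R).
Context (F : nat -> L0fun R T) (s : nat -> R).
Hypotheses (s0 : forall k, 0 < s k) (sS : forall k, s k.+1 <= s k / 2).
Hypothesis Fs : forall k, (mu (far d (s k) (F k) (F k.+1)) <= (s k)%:E)%E.

Let E k := far d (s k) (F k) (F k.+1).
(* Off [late k], the sequence moves by less than [s j] at every step [j >= k]. *)
Let late k : set (lebesgueR R) := [set t | exists j, E (k + j)%N t].

Let mE k : measurable (E k).
Proof. exact: (far_measurable dm dt bB). Qed.

Let late_measurable k : measurable (I01 `&` late k).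
Proof.
apply: countable_union_measurable => j; apply: measurableI => //.
exact: measurable_I01.
Qed.

Let s2_ge0 k : 0 <= 2 * s k.
Proof. by apply: mulr_ge0 => //; exact: ltW. Qed.

Let mu_late k : (mu (I01 `&` late k) <= (2 * s k)%:E)%E.
Proof.
apply: (@le_trans _ _ (\sum_(k <= i <oo) mu (E i))%E).
  apply: measure_sigma_subadditive_tail => //.
  move=> t [It [j Ej]]; exists (k + j)%N => //=.
  by apply/negP; rewrite -leqNgt leq_addr.
apply: lime_le; first exact: is_cvg_nneseries.
apply: nearW => m; have [km|mk] := leqP k m; last first.
  by rewrite big_geq ?lee_fin ?s2_ge0//; exact: ltnW.
apply: (@le_trans _ _ (\sum_(k <= i < m) (s i)%:E)%E).
  by apply: lee_sum => i _; exact: Fs.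
rewrite sumEFin lee_fin -(subnKC km); apply: (le_trans (geometric_sum_le sS _ _)).
by rewrite gerBl s2_ge0.
Qed.

Let not_late k t : I01 t -> ~ late k t ->
  forall i, (k <= i)%N -> d (F i t) (F i.+1 t) <= s i.
Proof.
move=> It nl i ki; rewrite leNgt; apply/negP => sd; apply: nl.
by exists (i - k)%N; rewrite subnKC//; split=> //=; exact: ltW.
Qed.

Let good : set (lebesgueR R) := [set t | exists k, ~ late k t].

Let good_cvg t : I01 t -> good t -> exists l : T, (fun k => F k t) @ \oo --> l.
Proof. by move=> It [k nl]; exact: (fast_cvg dm s0 sS (not_late It nl)). Qed.

(** A fast Cauchy sequence in measure converges almost everywhere, by
    Borel--Cantelli. Off a set of measure at most [2 * s k] all steps from the
    [k]-th on are small, and there the limit is within [2 * s k] of [F k]. *)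
Lemma L0fun_complete :
  exists f : L0fun R T, forall k, near d (3 * s k) (F k) f.
Proof.
have [d0 dC dD] := dm.
have /choice[l lP] : forall t, exists y, (I01 t -> good t ->
    (fun k => F k t) @ \oo --> y) /\ (~ good t -> y = F 0%N t).
  move=> t; have [gt|ngt] := pselect (good t); last by exists (F 0%N t).
  have [It|nIt] := pselect (I01 t); last by exists (F 0%N t).
  by have [y Fy] := good_cvg It gt; exists y.
have good_measurable : measurable (I01 `&` good).
  by apply: countable_union_measurable => k; exact: I01_setC_measurable.
have inv_ball m t : nbhs (l t) [set y | d (l t) y < m.+1%:R^-1].
  by apply: metric_ball_nbhs => //; rewrite invr_gt0.
have lm : lebesgue_measurable_fun l.
  move=> U oU.
  (* A limit lies in [U] if and only if the sequence is eventually inside [U]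
     by a fixed margin. *)
  rewrite (_ : _ `&` _ = I01 `&` [set t |
      (good t /\ exists p : nat * nat, forall j,
        shrink d p.1.+1%:R^-1 U (F (p.2 + j)%N t)) \/ (~ good t /\ U (F 0%N t))]).
    apply: I01_setU_measurable; apply: I01_setI_measurable => //.
    - apply: countable_union_measurable => p; apply: countable_inter_measurable.
      by move=> j; apply: preimage_closed_measurable; exact: (shrink_closed dm dt).
    - exact: I01_setC_measurable.
    - exact: L0fun_measurable.
  apply/seteqP; split=> t [It Ut]; split=> //; last first.
    case: Ut => [[gt [[m N] sh]]|[ngt]] /=; last by rewrite ((lP t).2 ngt).
    have := (lP t).1 It gt _ (inv_ball m t).
    move=> [M _ /(_ (N + M)%N (leq_addl _ _))] /=; rewrite dC => FU.
    exact: (sh M _ FU).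
  have [gt|ngt] := pselect (good t); last first.
    by right; split=> //; rewrite -((lP t).2 ngt).
  left; split=> //; have /dt[e e0 eU] := open_nbhs_nbhs (conj oU Ut).
  have e20 : 0 < e / 2 by rewrite divr_gt0.
  have [m _ /(_ m)/(_ (leqnn _)) /= me] := near_infty_natSinv_lt (PosNum e20).
  have [N _ Nl] := (lP t).1 It gt _ (inv_ball m t).
  exists (m, N) => j z /= Fz; apply: eU => /=.
  apply: (le_lt_trans (dD _ (F (N + j)%N t) _)).
  rewrite [e]splitr; apply: ltrD; last exact: lt_trans me.
  exact: lt_trans (Nl (N + j)%N (leq_addr _ _)) me.
exists (MkL0fun lm) => k; rewrite /near.
apply: (@le_lt_trans _ _ (2 * s k)%:E); last first.
  by rewrite lte_fin; have := s0 k; lra.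
apply: le_trans (mu_late k).
apply: le_mu; [exact: (far_measurable dm dt bB)|exact: late_measurable|].
move=> t [It /= sd]; split=> //; apply: contrapT => nl.
suff : d (F k t) (l t) <= 2 * s k by have := s0 k; lra.
apply/ler_addgt0Pr => e e0.
have gt : good t by exists k.
have [M _ /(_ (k + M)%N (leq_addl _ _))] /= :=
  (lP t).1 It gt _ (metric_ball_nbhs dt (l t) e0).
rewrite dC => Fl; apply: (le_trans (dD _ (F (k + M)%N t) _)).
by apply: lerD (ltW Fl); exact: (fast_dist_le dm s0 sS (not_late It nl)).
Qed.

End completeness_in_measure.

(** * The topology of L0 through a metric *)

Section topology_of_L0.
Context {R : realType} {G : polishGroupType R} (d : G -> G -> R) (B : nat -> set G).
Hypotheses (dm : is_metric d) (dt : metrizes d) (bB : countable_basis B).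
Local Notation mu := (@completed_lebesgue_measure R).
Local Open Scope quotient_scope.
Implicit Types a b : L0 R G.

Let open_shrinking (f : L0fun R G) (O : nat -> set G) (e : R) :
  (forall k, open (O k)) -> (forall k m, (k <= m)%N -> O m `<=` O k) ->
  (forall y, exists k, ~ O k y) -> 0 < e ->
  exists k, (mu (I01 `&` f @^-1` O k) < e%:E)%E.
Proof.
move=> oO Od O0 e0; apply: (@mu_shrinking _ (fun k => I01 `&` f @^-1` O k)) => //.
- by move=> k; exact: L0fun_measurable.
- by move=> k m km t [It /= Om]; split=> //; exact: Od Om.
- by move=> t; have [k Ok] := O0 (f t); exists k => -[].
Qed.

(** The topology of [L0 R G] is defined through the condition that [a^-1 * b] is
    mostly close to [1]; here it is compared with the condition that [a] and [b]
    are mostly close for an arbitrary metric on [G]. The two notions of closeness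
    at a point [y] of [G] agree at a rate that depends on [y], but this rate is
    uniform when [y = a t] and [t] stays off a set of small measure. *)
Lemma nbhs_L0P a A : nbhs a A <->
  exists2 r, 0 < r & [set b | near d r (repr a) (repr b)] `<=` A.
Proof.
have [d0 dC dD] := dm.
have aE b : (a^-1 * b)%g =
    \pi_(L0 R G) (L0fun_mul (L0fun_inv (repr a)) (repr b)).
  by rewrite -L0_mulE -L0_invE !reprK.
have mbad V b : open V -> measurable (I01 `&`
    [set t | ~ V (L0fun_mul (L0fun_inv (repr a)) (repr b) t)]).
  by move=> oV; apply/I01_setC_measurable/L0fun_measurable.
split=> [[[V e] [/= [oV V1] e0] VA]|[r r0 rA]].
  have /dt[q q0 qV] := open_nbhs_nbhs (conj oV V1).
  (* The points at which the rate [k.+1%:R^-1] fails. *)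
  pose O k := [set y : G | exists2 z,
    d z y < k.+1%:R^-1 & q / 2 < d 1%g (y^-1 * z)%g].
  have e20 : 0 < e / 2 by rewrite divr_gt0.
  have oO k : open (O k).
    rewrite (_ : O k = \bigcup_z ([set y | d z y < k.+1%:R^-1] `&`
          (fun y => y^-1 * z)%g @^-1` [set y | q / 2 < d 1%g y])).
      apply: bigcup_open => z _; apply: openI; first exact: metric_ball_open.
      apply: open_comp; last exact: metric_gt_open.
      move=> y _.
      apply: (@continuous_comp _ _ _ (fun y => y^-1)%g (fun x => x * z)%g).
        exact: invg_continuous.
      exact: mulgr_continuous.
    by apply/seteqP; split=> [y [z zy qz]|y [z _ [zy qz]]]; exists z.
  have [k Ok] : exists k, (mu (I01 `&` repr a @^-1` O k) < (e / 2)%:E)%E.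
    apply: open_shrinking => //.
    - move=> k m km y [z zy qz]; exists z => //; apply: (lt_le_trans zy).
      by rewrite lef_pV2 ?posrE// ler_nat ltnS.
    - move=> y; have q20 : 0 < q / 2 by rewrite divr_gt0.
      have : nbhs (y^-1 * y)%g [set z | d 1%g z < q / 2].
        by rewrite mulVg; exact: metric_ball_nbhs.
      move=> /(@mulgl_continuous G y^-1%g y)/dt[s s0 sq].
      have [k _ /(_ k)/(_ (leqnn _)) /= ks] := near_infty_natSinv_lt (PosNum s0).
      exists k => -[z zy]; apply/negP; rewrite -leNgt; apply/ltW/sq => /=.
      by rewrite dC; exact: lt_trans ks.
  exists (Num.min k.+1%:R^-1 (e / 2)); first by rewrite lt_min e20 andbT.
  move=> b /= ab; rewrite /near in ab; apply: VA.
  change (L0_small (V, e) (a^-1 * b)%g).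
  rewrite aE; apply/L0_small_pi => //.
  apply: (@le_lt_trans _ _ (mu ((I01 `&` repr a @^-1` O k) `|`
      far d (Num.min k.+1%:R^-1 (e / 2)) (repr a) (repr b)))).
    apply: le_mu; first exact: mbad.
      apply: measurableU; last exact: (far_measurable dm dt bB).
      exact: L0fun_measurable.
    move=> t [It /= nV].
    have [fg|fg] := ltP (d (repr a t) (repr b t))
      (Num.min k.+1%:R^-1 (e / 2)); last by right.
    left; split=> //; exists (repr b t); rewrite lt_min dC in fg.
      by case/andP: fg.
    rewrite ltNge; apply/negP => dq; apply: nV; apply: qV => /=.
    by apply: (le_lt_trans dq); rewrite ltr_pdivrMr// ltr_pMr// ltr1n.
  have -> : (e%:E = (e / 2)%:E + (e / 2)%:E)%E by rewrite -EFinD -splitr.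
  apply: le_lt_trans (measureU2 _ _ _) _.
  - exact: L0fun_measurable.
  - exact: (far_measurable dm dt bB).
  - apply: lteD => //; apply: (lt_le_trans ab).
    by rewrite lee_fin ge_min lexx orbT.
pose O k := [set y : G | exists2 v,
  d 1%g v < k.+1%:R^-1 & r / 2 < d y (y * v)%g].
have r20 : 0 < r / 2 by rewrite divr_gt0.
have oO k : open (O k).
  rewrite openE => y [v v1 yv].
  have [e e0 ee] : exists2 e, 0 < e & r / 2 + e < d y (y * v)%g.
    exists ((d y (y * v)%g - r / 2) / 2); first by rewrite divr_gt0// subr_gt0.
    by lra.
  have : nbhs y ([set z | d y z < e / 2] `&`
      (fun z => z * v)%g @^-1` [set z | d (y * v)%g z < e / 2]).
    apply: filterI; first by apply: metric_ball_nbhs => //; rewrite divr_gt0.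
    by apply: mulgr_continuous; apply: metric_ball_nbhs => //; rewrite divr_gt0.
  apply: filterS => z [/= yz yvz]; exists v => //.
  have := dD y z (y * v)%g; have := dD z (z * v)%g (y * v)%g.
  by rewrite [d (z * v)%g _]dC; lra.
have [k Ok] : exists k, (mu (I01 `&` repr a @^-1` O k) < (r / 2)%:E)%E.
  apply: open_shrinking => //.
  - move=> k m km y [v v1 yv]; exists v => //; apply: (lt_le_trans v1).
    by rewrite lef_pV2 ?posrE// ler_nat ltnS.
  - move=> y.
    have : nbhs (y * 1)%g [set z | d y z < r / 2].
      by rewrite mulg1; exact: metric_ball_nbhs.
    move=> /(@mulgl_continuous G y 1%g)/dt[s s0 sq].
    have [k _ /(_ k)/(_ (leqnn _)) /= ks] := near_infty_natSinv_lt (PosNum s0).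
    exists k => -[v v1]; apply/negP; rewrite -leNgt; apply/ltW/sq => /=.
    exact: lt_trans ks.
pose V := [set v : G | d 1%g v < k.+1%:R^-1].
have oV : open V by exact: metric_ball_open.
exists (V, r / 2).
  by split=> //=; split=> //; rewrite /V/= (d0 _ _).2.
move=> b ab; apply: rA.
have {}ab : L0_small (V, r / 2) (a^-1 * b)%g by [].
rewrite aE in ab; move/(L0_small_pi _ _ oV) : ab => ab.
rewrite /= /near.
apply: (@le_lt_trans _ _ (mu ((I01 `&` repr a @^-1` O k) `|` (I01 `&`
    [set t | ~ V (L0fun_mul (L0fun_inv (repr a)) (repr b) t)])))).
  apply: le_mu; first exact: (far_measurable dm dt bB).
    by apply: measurableU; [exact: L0fun_measurable|exact: mbad].
  move=> t [It /= rt].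
  have [Vt|nVt] := pselect (V ((repr a t)^-1 * repr b t)%g); last by right.
  left; split=> //; exists ((repr a t)^-1 * repr b t)%g => //.
  by rewrite mulVKg; lra.
have -> : (r%:E = (r / 2)%:E + (r / 2)%:E)%E by rewrite -EFinD -splitr.
apply: le_lt_trans (measureU2 _ _ _) _ => //.
- exact: L0fun_measurable.
- exact: mbad.
- exact: lteD.
Qed.

End topology_of_L0.

(** * Tuples in L0 and the Baire property *)

Section tuples.
Context {R : realType} {G : polishGroupType R} (n : nat).
Local Notation mu := (@completed_lebesgue_measure R).
Local Notation X := {ptws 'I_n -> G}.
Local Notation L := {ptws 'I_n -> L0 R G}.
Local Open Scope quotient_scope.

Let tuple_measurable (f : 'I_n -> L0fun R G) :
  lebesgue_measurable_fun (fun t => (fun i => f i t) : X).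
Proof.
have [d [dm dt _]] := @polish_completely_metrizable R G.
have [B [oB bB]] := metric_countable_basis (1%g : G) dm dt (@polish_separable R G).
move=> U oU.
rewrite (_ : _ `&` _ = I01 `&` [set t | exists c : {ffun 'I_n -> nat},
    ([set y : X | forall i, B (c i) (y i)] `<=` U) /\ (forall i, B (c i) (f i t))]).
  apply: countable_union_measurable => c; apply: prop_measurable.
  by apply: countable_inter_measurable => i; exact: L0fun_measurable.
apply/seteqP; split=> t [It Ut]; split=> //; last by case: Ut => c [cU /cU].
have /nbhs_ptwsP[P fP PU] := open_nbhs_nbhs (conj oU Ut).
have /choice[c cP] : forall i, exists m, B m (f i t) /\ B m `<=` P i.
  by move=> i; have [m ? ?] := bB _ _ (fP i); exists m.
exists [ffun i => c i]; split=> [y By|i]; last by rewrite ffunE; case: (cP i).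
by apply: PU => i; have := By i; rewrite ffunE; apply: (cP i).2.
Qed.

Definition tuple_fun (a : L) : L0fun R X :=
  MkL0fun (tuple_measurable (fun i => repr (a i))).

Let proj_measurable (f : L0fun R X) i :
  lebesgue_measurable_fun (fun t => f t i).
Proof.
move=> U oU; apply: (L0fun_measurable f (U := proj i @^-1` U)).
by apply: open_comp => // x _; exact: (@proj_continuous _ (fun=> G) i x).
Qed.

(** The inverse of [tuple_fun], up to almost everywhere equality. *)
Definition class_tuple (f : L0fun R X) : L :=
  fun i => \pi_(L0 R G) (MkL0fun (proj_measurable f i)).

Lemma tuple_fun_class (f : L0fun R X) :
  {ae mu, forall t, I01 t -> tuple_fun (class_tuple f) t = f t}.
Proof.
have : {ae mu, forall t, forall i, I01 t ->
    (repr (class_tuple f i) : L0fun R G) t = f t i}.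
  apply: (@filter_forall _ _ (fun i t => I01 t ->
    (repr (class_tuple f i) : L0fun R G) t = f t i)) => i.
  exact: repr_pi_ae (MkL0fun (proj_measurable f i)).
by apply: filterS => t ft It; apply/funext => i; exact: ft.
Qed.

Lemma tuple_fun_diag_conj (h : L0 R G) (a : L) :
  {ae mu, forall t, I01 t -> tuple_fun (diag_conj h a) t =
    diag_conj ((repr h : L0fun R G) t) (tuple_fun a t)}.
Proof.
have : {ae mu, forall t, forall i, I01 t ->
    (repr (h * a i * h^-1)%g : L0fun R G) t =
    ((repr h : L0fun R G) t * (repr (a i) : L0fun R G) t *
     ((repr h : L0fun R G) t)^-1)%g}.
  apply: (@filter_forall _ _ (fun i t => I01 t ->
    (repr (h * a i * h^-1)%g : L0fun R G) t =
    ((repr h : L0fun R G) t * (repr (a i) : L0fun R G) t *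
     ((repr h : L0fun R G) t)^-1)%g)) => i.
  have -> : (h * a i * h^-1)%g = \pi_(L0 R G) (L0fun_mul
      (L0fun_mul (repr h) (repr (a i))) (L0fun_inv (repr h))).
    by rewrite -!L0_mulE -L0_invE !reprK.
  exact: repr_pi_ae.
by apply: filterS => t ht It; apply/funext => i; exact: ht.
Qed.

Section neighbourhoods.
Context (d : G -> G -> R) (B : nat -> set G) (BX : nat -> set X).
Hypotheses (dm : is_metric d) (dt : metrizes d).
Hypotheses (bB : countable_basis B) (bBX : countable_basis BX).
Local Notation D := (@max_dist n G R d).

Let Dm : is_metric D. Proof. exact: max_dist_metric. Qed.
Let Dt : metrizes D. Proof. exact: max_dist_metrizes. Qed.

Lemma mu_far_tuple_le (r : R) (a b : L) (e : R) : 0 < r ->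
  (forall i, (mu (far d r (repr (a i)) (repr (b i))) <= e%:E)%E) ->
  (mu (far D r (tuple_fun a) (tuple_fun b)) <= (n%:R * e)%:E)%E.
Proof.
move=> r0 abe.
pose A k := if insub k is Some i then far d r (repr (a i)) (repr (b i)) else set0.
have mA k : measurable (A k).
  rewrite /A; case: insub => [i|]; last exact: measurable0.
  exact: (far_measurable dm dt bB).
apply: (@le_trans _ _ (mu (\big[setU/set0]_(k < n) A k))).
  apply: le_mu; first exact: (far_measurable Dm Dt bBX).
    by apply: bigsetU_measurable.
  move=> t [It]; rewrite /= leNgt => /negP rD.
  have [i rdi] : exists i,
      ~ d ((repr (a i) : L0fun R G) t) ((repr (b i) : L0fun R G) t) < r.
    apply/existsNP => abr; apply: rD; exact/max_dist_ltP.
  rewrite -bigcup_mkord; exists (val i) => /=; first exact: ltn_ord.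
  by rewrite /A valK; split=> //=; rewrite leNgt; apply/negP.
apply: (le_trans (Boole_inequality _ _)) => //.
apply: (@le_trans _ _ (\sum_(k < n) e%:E)%E).
  apply: lee_sum => k _; rewrite /A; case: insubP => [i _ _|]; first exact: abe.
  by rewrite ltn_ord.
by rewrite sumEFin lee_fin sumr_const card_ord mulr_natl.
Qed.

(** The product topology on tuples of classes is convergence in measure of
    [X]-valued functions for the maximum metric. *)
Lemma nbhs_L0_tupleP (a : L) A : nbhs a A <->
  exists2 r, 0 < r & [set b | near D r (tuple_fun a) (tuple_fun b)] `<=` A.
Proof.
split=> [/nbhs_ptwsP[P aP PA]|[r r0 rA]].
  have /choice[r rP] : forall i, exists r, 0 < r /\
      [set b | near d r (repr (a i)) (repr b)] `<=` P i.
    by move=> i; have /(nbhs_L0P dm dt bB)[r ? ?] := aP i; exists r.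
  pose q := \big[Num.min/1]_(i < n) r i.
  have q0 : 0 < q by apply: lt_bigmin => // i _; case: (rP i).
  have qr i : q <= r i by exact: bigmin_le.
  exists q => // b ab; apply: PA => i; apply: (rP i).2.
  apply: (@lt_le_trans _ _ q%:E); last by rewrite lee_fin.
  apply: le_lt_trans ab; apply: le_mu.
  - exact: (far_measurable dm dt bB).
  - exact: (far_measurable Dm Dt bBX).
  - move=> t [It rd]; split=> //=; apply: (le_trans (qr i)).
    apply: (le_trans rd).
    exact: (le_max_dist d (tuple_fun a t) (tuple_fun b t) i).
have n10 : 0 < n.+1%:R :> R by rewrite ltr0n.
pose q := r / n.+1%:R.
have q0 : 0 < q by rewrite divr_gt0.
apply/nbhs_ptwsP; exists (fun i => [set b | near d q (repr (a i)) (repr b)]).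
  by move=> i; apply/(nbhs_L0P dm dt bB); exists q.
move=> b ab; apply: rA; rewrite /= /near.
have qr : q <= r by rewrite ler_pdivrMr// ler_peMr ?(ltW r0)// ler1n.
apply: (@le_lt_trans _ _ (mu (far D q (tuple_fun a) (tuple_fun b)))).
  by apply: le_mu; [exact: (far_measurable Dm Dt bBX)..|exact: far_sub].
apply: (@le_lt_trans _ _ (n%:R * q)%:E).
  by apply: mu_far_tuple_le => // i; apply: ltW; exact: ab.
rewrite lte_fin /q mulrCA gtr_pMr// ltr_pdivrMr// mul1r ltr_nat.
exact: ltnSn.
Qed.

Lemma near_tuple_class r (f : L0fun R X) (g : L0fun R X) :
  near D r f g -> near D r f (tuple_fun (class_tuple g)).
Proof.
apply: le_lt_trans; apply: le_mu_ae.
- exact: (far_measurable Dm Dt bBX).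
- exact: (far_measurable Dm Dt bBX).
- apply: filterS (tuple_fun_class g) => t gE [It rt]; split=> //.
  by rewrite /= -gE.
Qed.

Hypothesis dc : metric_complete d.

(** The Baire property of the finite powers of [L0 R G], by the classical
    argument with shrinking balls; the limit comes from completeness in
    measure. *)
Lemma comeager_L0_tuple_meets (A O : set L) :
  comeager A -> open O -> O !=set0 -> A `&` O !=set0.
Proof.
move=> /comeagerP[U Uod UA] oO [a0 Oa0].
(* Radii are divided by [3] in the steps because the limit of a sequence whose
   steps are [r k / 3]-near, with [r] at least halved each time, is [r k]-near to
   the [k]-th term. *)
pose V k := if k is k'.+1 then U k' else O.
pose ok k (p : L * R) := 0 < p.2 /\
  [set b | near D p.2 (tuple_fun p.1) (tuple_fun b)] `<=` V k.
have [p0 ok0] : exists p, ok 0%N p.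
  have /nbhs_L0_tupleP[r r0 rO] := open_nbhs_nbhs (conj oO Oa0).
  by exists (a0, r).
have step k p : exists q, ok k p -> [/\ ok k.+1 q, q.2 <= p.2 / 2 &
    near D (p.2 / 3) (tuple_fun p.1) (tuple_fun q.1)].
  have [[p20 pV]|] := pselect (ok k p); last by exists p.
  pose N := [set b | near D (p.2 / 3) (tuple_fun p.1) (tuple_fun b)].
  have p30 : 0 < p.2 / 3 by rewrite divr_gt0.
  have Np : nbhs p.1 N by apply/nbhs_L0_tupleP; exists (p.2 / 3).
  have [oU dU] := Uod k.
  have [b [Nb Ub]] := dU N° (ex_intro _ p.1 Np) (open_interior _).
  have /nbhs_L0_tupleP[r r0 rU] := open_nbhs_nbhs (conj oU Ub).
  exists (b, Num.min r (p.2 / 2)) => _; split=> /=.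
  - split=> /=; first by rewrite lt_min r0 divr_gt0.
    move=> c bc; apply: rU; apply: (@lt_le_trans _ _ (Num.min r (p.2 / 2))%:E).
      apply: le_lt_trans bc; apply: le_mu.
      + exact: (far_measurable Dm Dt bBX).
      + exact: (far_measurable Dm Dt bBX).
      + by apply: far_sub; rewrite ge_min lexx.
    by rewrite lee_fin ge_min lexx.
  - by rewrite ge_min lexx orbT.
  - exact: (interior_subset Nb).
have [next nextP] := choice (fun kp : nat * (L * R) => step kp.1 kp.2).
pose p := fix p k := if k is k'.+1 then next (k', p k') else p0.
have okp k : ok k (p k).
  by elim: k => [//|k IH]; case: (nextP (k, p k) IH).
have pS k : (p k.+1).2 <= (p k).2 / 2 by case: (nextP (k, p k) (okp k)).
have pN k : near D ((p k).2 / 3) (tuple_fun (p k).1) (tuple_fun (p k.+1).1).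
  by case: (nextP (k, p k) (okp k)).
have [f fP] := @L0fun_complete R X D BX Dm Dt bBX (max_dist_complete dc)
  (fun k => tuple_fun (p k).1) (fun k => (p k).2 / 3)
  (fun k => divr_gt0 (okp k).1 (ltr0Sn _ _))
  (ltac:(by move=> k; have := pS k; lra))
  (fun k => ltW (pN k)).
have fV k : V k (class_tuple f).
  apply: (okp k).2; apply: near_tuple_class; have := fP k.
  by rewrite mulrC divfK.
exists (class_tuple f); split; last exact: (fV 0%N).
by apply: UA => k _; exact: (fV k.+1).
Qed.

End neighbourhoods.
End tuples.

(** * Generic tuples *)

Section generic_tuples.
Context {R : realType} {G : polishGroupType R} (n : nat).
Local Notation mu := (@completed_lebesgue_measure R).
Local Notation X := {ptws 'I_n -> G}.
Local Notation L := {ptws 'I_n -> L0 R G}.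
Context (d : G -> G -> R) (B : nat -> set G) (BX : nat -> set X).
Hypotheses (dm : is_metric d) (dt : metrizes d).
Hypotheses (bB : countable_basis B) (bBX : countable_basis BX).
Local Notation D := (@max_dist n G R d).

Let Dm : is_metric D. Proof. exact: max_dist_metric. Qed.
Let Dt : metrizes D. Proof. exact: max_dist_metrizes. Qed.

Section random_open_set.
Context (J : countType) (S : J -> set (lebesgueR R)) (W : J -> set X).
Hypotheses (mS : forall j, measurable (I01 `&` S j)) (oW : forall j, open (W j)).

(** An open set depending on [t], given by countably many pieces so that it
    depends on [t] in a measurable way. *)
Definition random_open t : set X := [set y | exists j, S j t /\ W j y].

Definition outside (f : L0fun R X) : set (lebesgueR R) :=
  I01 `&` [set t | ~ random_open t (f t)].

Lemma outside_measurable f : measurable (outside f).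
Proof.
apply: I01_setC_measurable; apply: countable_union_measurable => j.
by apply: I01_setI_measurable => //; exact: L0fun_measurable.
Qed.

Lemma outside_ae_eq (f g : L0fun R X) : {ae mu, forall t, I01 t -> f t = g t} ->
  mu (outside f) = mu (outside g).
Proof.
move=> fg; apply/eqP; rewrite eq_le; apply/andP.
split; (apply: le_mu_ae; [exact: outside_measurable|exact: outside_measurable|]);
  by apply: filterS fg => t fgt [It nt]; split=> //=; rewrite ?fgt// -fgt.
Qed.

(** Most values of [f] that lie in the random open set do so by a margin
    [k.+1%:R^-1], if [k] is large, and then survive a small change of [f]. *)
Lemma mostly_inside_open e :
  open [set a : L | (mu (outside (tuple_fun a)) < e%:E)%E].
Proof.
rewrite openE => a /= ae; apply/(nbhs_L0_tupleP dm dt bB bBX).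
set f := tuple_fun a in ae *.
pose E k : set (lebesgueR R) := (I01 `&` [set t | (exists j, S j t /\ W j (f t)) /\
  ~ exists j, S j t /\ shrink D k.+1%:R^-1 (W j) (f t)]).
have mE k : measurable (E k).
  apply: I01_setI_measurable.
    apply: countable_union_measurable => j; apply: I01_setI_measurable => //.
    exact: L0fun_measurable.
  apply: I01_setC_measurable; apply: countable_union_measurable => j.
  apply: I01_setI_measurable => //; apply: preimage_closed_measurable.
  exact: (shrink_closed Dm Dt).
have [b bE be] : exists2 b : R, mu (outside f) = b%:E & b < e.
  have : (0 <= mu (outside f))%E by [].
  by case: (mu (outside f)) ae => [b|//|//]; rewrite lte_fin; exists b.
pose q := (e - b) / 2; have q0 : 0 < q by rewrite divr_gt0// subr_gt0.
have [k Ek] : exists k, (mu (E k) < q%:E)%E.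
  apply: mu_shrinking => //; first by move=> k t [].
  - move=> k m km t [It [? nE]]; split=> //; split=> // -[j [Sj sj]].
    apply: nE; exists j; split=> // y ty; apply: sj; apply: (lt_le_trans ty).
    by rewrite lef_pV2 ?posrE// ler_nat ltnS.
  - move=> t; have [[j [Sj Wj]]|nj] := pselect (random_open t (f t)); last first.
      by exists 0%N => -[_ []].
    have /Dt[s s0 sW] := open_nbhs_nbhs (conj (oW j) Wj).
    have [k _ /(_ k)/(_ (leqnn _)) /= ks] := near_infty_natSinv_lt (PosNum s0).
    exists k => -[_ [_]]; apply; exists j; split=> // y ty.
    by apply: sW; exact: lt_trans ks.
exists (Num.min k.+1%:R^-1 q); first by rewrite lt_min q0 andbT.
move=> c /=; rewrite /near -/f; set r := Num.min _ _ => fc.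
apply: (@le_lt_trans _ _
    (mu (outside f `|` (E k `|` far D r f (tuple_fun c))))).
  apply: le_mu; first exact: outside_measurable.
    apply: measurableU; first exact: outside_measurable.
    by apply: measurableU => //; exact: (far_measurable Dm Dt bBX).
  move=> t [It nc].
  have [ft|nft] := pselect (random_open t (f t)); last by left.
  right; have [fct|fct] := ltP (D (f t) (tuple_fun c t)) r; last by right.
  left; split=> //; split=> // -[j [Sj sj]]; apply: nc; exists j; split=> //.
  by apply: sj; apply: (lt_le_trans fct); rewrite ge_min lexx.
have mF : measurable (far D r f (tuple_fun c)) by exact: (far_measurable Dm Dt bBX).
apply: le_lt_trans (le_muU _ _) _ => //; first exact: outside_measurable.
  exact: measurableU.
have -> : e%:E = (b%:E + (q%:E + q%:E))%E.
  by rewrite -!EFinD -splitr addrC subrK.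
rewrite bE lteD2lE//.
apply: le_lt_trans (le_muU _ _) _ => //.
apply: lteD => //; apply: (lt_le_trans fc).
by rewrite lee_fin ge_min lexx orbT.
Qed.

Hypothesis dense_random : forall t, I01 t -> dense (random_open t).

(** A tuple is moved into the random dense open set, without moving any of its
    values much, by choosing among the points of a fixed dense sequence. *)
Lemma approx_inside (a : L) (r : R) : 0 < r -> exists2 b : L,
  near D r (tuple_fun a) (tuple_fun b) & mu (outside (tuple_fun b)) = 0%E.
Proof.
have [D0 _ _] := Dm.
move=> r0; have [z zd] := basis_dense_seq ((fun=> 1%g) : X) bBX.
set f := tuple_fun a.
have [g gP] : exists g : L0fun R X, forall t, I01 t -> exists2 i,
    D (f t) (z i) < r /\ random_open t (z i) & g t = z i.
  apply: (@countable_choice_measurable R X z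
    (fun i => [set t | D (f t) (z i) < r /\ random_open t (z i)])).
    move=> i; apply: I01_setI_measurable.
      rewrite (_ : _ `&` _ = I01 `&` f @^-1` [set y | D (z i) y < r]).
        by apply: L0fun_measurable; exact: metric_ball_open.
      have [_ DC _] := Dm.
      by apply/seteqP; split=> t [It zr]; split=> //; rewrite /= DC.
    apply: countable_union_measurable => j.
    rewrite (_ : _ `&` _ = I01 `&` [set t | W j (z i) /\ S j t]).
      exact: prop_measurable.
    by apply/seteqP; split=> t [It []].
  move=> t It.
  have ftr : [set y | D (f t) y < r] (f t) by rewrite /= (D0 _ _).2.
  have [y [/= fy [j [Sj Wy]]]] :=
    dense_random It (ex_intro _ _ ftr) (metric_ball_open Dm Dt _ _).
  have oO : open ([set y | D (f t) y < r] `&` W j).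
    by apply: openI => //; exact: metric_ball_open.
  have [i [fz Wz]] := zd _ oO (ex_intro _ y (conj fy Wy)).
  by exists i; split=> //; exists j.
exists (class_tuple g).
  apply: (near_tuple_class dm dt bBX); rewrite /near (_ : far _ _ _ _ = set0).
    by rewrite measure0 lte_fin.
  apply/seteqP; split=> // t [It] /=; have [i [fz _] gE] := gP t It.
  by rewrite gE leNgt fz.
rewrite (outside_ae_eq (tuple_fun_class g)) (_ : outside g = set0) ?measure0//.
apply/seteqP; split=> // t [It] /=; have [i [_ zt] gE] := gP t It.
by rewrite gE.
Qed.

Lemma comeager_inside : comeager
  [set a : L | {ae mu, forall t, I01 t -> random_open t (tuple_fun a t)}].
Proof.
apply: (@comeager_countable _ _ (fun k : nat =>
  [set a : L | (mu (outside (tuple_fun a)) < (k.+1%:R^-1)%:E)%E])).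
  move=> k; split; first exact: mostly_inside_open.
  move=> O [a Oa] oO.
  have /(nbhs_L0_tupleP dm dt bB bBX)[r r0 rO] := open_nbhs_nbhs (conj oO Oa).
  have [b ab b0] := approx_inside a r0.
  by exists b; split; [exact: rO|rewrite /= b0 lte_fin].
move=> a ak; exists (outside (tuple_fun a)); split.
- exact: outside_measurable.
- apply/eqP; rewrite eq_le measure_ge0 andbT.
  apply/lee_addgt0Pr => e e0; rewrite add0e.
  have [k _ /(_ k)/(_ (leqnn _)) /= ke] := near_infty_natSinv_lt (PosNum e0).
  by apply: (le_trans (ltW (ak k _))); rewrite // lee_fin ltW.
- by move=> t /= /not_implyP.
Qed.

End random_open_set.

(** The interior of the closure of [M (f t)] and the exterior of [M (f t)]
    together form a dense open set, cut out by countably many conditions on [t]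
    which are measurable because [M] is lower semicontinuous. *)
Lemma generic_interior_closure (M : X -> set X) (f : L0fun R X) :
  (forall U, open U -> open [set y | M y `&` U !=set0]) ->
  comeager [set a : L | {ae mu, forall t, I01 t ->
    M (f t) (tuple_fun a t) -> nbhs (tuple_fun a t) (closure (M (f t)))}].
Proof.
move=> Mlsc; have [oBX nBX] := bBX.
pose hit m : set (lebesgueR R) := [set t | M (f t) `&` BX m !=set0].
have mhit m : measurable (I01 `&` hit m).
  by apply: (L0fun_measurable f (U := [set y | M y `&` BX m !=set0])); exact: Mlsc.
pose inner m : set (lebesgueR R) := [set t | forall i,
  BX i `<=` BX m -> BX i !=set0 -> hit i t].
have minner m : measurable (I01 `&` inner m).
  apply: countable_inter_measurable => i.
  have [im|nim] := pselect (BX i `<=` BX m /\ BX i !=set0).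
    rewrite (_ : _ `&` _ = I01 `&` hit i)//.
    by apply/seteqP; split=> t [It hi]; split=> //; apply: hi; case: im.
  rewrite (_ : _ `&` _ = I01); first exact: measurable_I01.
  apply/seteqP; split=> t; first by case.
  by move=> It; split=> // ? ?; exfalso; exact: nim.
(* The index [(m, true)] stands for a basic open set in the closure of
   [M (f t)], and [(m, false)] for one disjoint from [M (f t)]. *)
pose S (j : nat * bool) : set (lebesgueR R) := if j.2 then inner j.1 else ~` hit j.1.
have innerP m t : inner m t -> BX m `<=` closure (M (f t)).
  move=> it y my N yN.
  have [i iy iN] : exists2 i, BX i y & BX i `<=` N `&` BX m.
    by apply: nBX; apply: filterI => //; exact: open_nbhs_nbhs.
  have [z [Mz iz]] := it i (fun x ix => (iN x ix).2) (ex_intro _ y iy).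
  by exists z; split=> //; case: (iN z iz).
apply: comeagerS (@comeager_inside _ S (fun j => BX j.1) _ _ _).
- move=> a; apply: filterS => t ta It Ma.
  have [[m []] [/= Sm ma]] := ta It.
    apply: (@filterS _ _ _ (BX m)); first exact: innerP.
    exact: open_nbhs_nbhs.
  by exfalso; apply: Sm; exists (tuple_fun a t).
- move=> [m []]; rewrite /S /=; first exact: minner.
  exact: I01_setC_measurable.
- by move=> [m b]; exact: oBX.
- move=> t It O [y Oy] oO.
  have [[i [iO [z iz] nh]]|nO] :=
      pselect (exists i, [/\ BX i `<=` O, BX i !=set0 & ~ hit i t]).
    by exists z; split; [exact: iO|exists (i, false)].
  have [m my mO] := nBX _ _ (open_nbhs_nbhs (conj oO Oy)).
  exists y; split=> //; exists (m, true); split=> //= i im i0.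
  by apply: contrapT => nh; apply: nO; exists i; split=> // x /im/mO.
Qed.

Hypothesis dc : metric_complete d.

Context (a0 : L).
Hypothesis ca0 : comeager (diag_class a0).
Let f0 := tuple_fun a0.

(** A single generic member [h.a0] of the orbit serves all [V k] at once. At
    almost every [t], its value is [(g j * v).(f0 t)] with [v] in [V k], for some
    [j]; by genericity it is interior to the closure of [(g j * V k).(f0 t)], and
    moving it back to [f0 t] turns [g j * V k] into [v^-1 * V k]. *)
Lemma generic_value_locally_dense :
  {ae mu, forall t, I01 t -> locally_dense (diag_conj (H := G) (n := n)) (f0 t)}.
Proof.
have [g gd] := basis_dense_seq (1%g : G) bB.
have [d0 dC dD] := dm.
pose V k := [set v : G | d 1%g v < k.+1%:R^-1].
have oV k : open (V k) by exact: metric_ball_open.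
have V1 k : V k 1%g by rewrite /V/= (d0 _ _).2.
pose M (jk : nat * nat) (y : X) : set X :=
  (fun v => diag_conj (g jk.1 * v)%g y) @` V jk.2.
have Mlsc jk U : open U -> open [set y | M jk y `&` U !=set0].
  move=> oU; rewrite (_ : [set y | _] =
      \bigcup_(v in V jk.2) (fun y => diag_conj (g jk.1 * v)%g y) @^-1` U).
    apply: bigcup_open => v _; apply: open_comp => // y _.
    exact: (@diag_conj_continuousr G n _ y).
  apply/seteqP; split=> [y [_ [[v Vv <-] Uv]]|y [v Vv Uv]]; first by exists v.
  by exists (diag_conj (g jk.1 * v)%g y); split=> //; exists v.
have cM := comeager_bigcap (fun jk => generic_interior_closure f0 (Mlsc jk)).
have [a [[[h _ ha] Ma] _]] := comeager_L0_tuple_meets dm dt bB bBX dc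
  (comeagerI ca0 cM) openT (ex_intro _ a0 I).
have aeM : {ae mu, forall t, forall jk, I01 t -> M jk (f0 t) (tuple_fun a t) ->
    nbhs (tuple_fun a t) (closure (M jk (f0 t)))}.
  exact: ae_countable (fun jk => Ma jk I).
have aeh := tuple_fun_diag_conj h a0; rewrite ha in aeh.
apply: filterS2 aeM aeh => t Mt ht It N N1.
have [k kN] : exists k, forall u v, V k u -> V k v -> N (u^-1 * v)%g.
  have : nbhs ((1^-1 : G) * 1)%g N by rewrite invg1 mulg1.
  case/(@mulg_continuous G (1^-1%g, 1%g)) => -[P Q] /= [/invg_continuous P1 Q1] PQ.
  have /dt[s s0 sPQ] : nbhs (1%g : G) ((fun x => x^-1)%g @^-1` P `&` Q).
    exact: filterI.
  have [k _ /(_ k)/(_ (leqnn _)) /= ks] := near_infty_natSinv_lt (PosNum s0).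
  exists k => u v Vu Vv; apply: (PQ (u^-1, v)%g); split.
    by apply: (sPQ u _).1; exact: lt_trans ks.
  by apply: (sPQ v _).2; exact: lt_trans ks.
move: ht => /(_ It); set b := (repr h : L0fun R G) t => ht.
have [j Vj] : exists j, V k ((g j)^-1 * b)%g.
  have oU : open ((fun x => x^-1 * b)%g @^-1` V k).
    apply: open_comp => // x _.
    apply: (@continuous_comp _ _ _ (fun z => z^-1)%g (fun z => z * b)%g).
      exact: invg_continuous.
    exact: mulgr_continuous.
  by apply: (gd _ oU); exists b; rewrite /= mulVg.
have bE : b = (g j * ((g j)^-1 * b))%g by rewrite mulVKg.
have /(nbhs_closure_act (@diag_conj1 G n) (@diag_conjM G n)
    (@diag_conj_continuousr G n) b^-1%g) := Mt (j, k) It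
  (ex_intro2 _ _ _ Vj
    (etrans (congr1 (fun c => diag_conj c (f0 t)) (esym bE)) (esym ht))).
rewrite ht -diag_conjM mulVg diag_conj1; apply: filterS; apply: closureS.
move=> _ [_ [v Vv <-] <-]; exists (b^-1 * (g j * v))%g; last by rewrite diag_conjM.
by have := kN _ _ Vj Vv; rewrite invgM invgK mulgA.
Qed.

(** If the orbits of the values of [a0] missed a basic open set on a set of
    positive measure, then so would the values of every member of the orbit of
    [a0], and none of them could be near a constant function with value in that
    open set. *)
Lemma generic_value_dense_orbit :
  {ae mu, forall t, I01 t -> dense (range (fun g : G => diag_conj g (f0 t)))}.
Proof.
have [oBX nBX] := bBX.
suff : {ae mu, forall t, forall m, I01 t -> BX m !=set0 ->
    exists g : G, BX m (diag_conj g (f0 t))}.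
  apply: filterS => t tm It O [y Oy] oO.
  have [m my mO] := nBX _ _ (open_nbhs_nbhs (conj oO Oy)).
  have [g gm] := tm m It (ex_intro _ y my).
  by exists (diag_conj g (f0 t)); split; [exact: mO|exists g].
apply: ae_countable => m.
have [[u um0]|m0] := pselect (BX m !=set0); last by apply: aeW => t.
pose A : set (lebesgueR R) := I01 `&`
  [set t | ~ exists g : G, BX m (diag_conj g (f0 t))].
have mA : measurable A.
  apply: I01_setC_measurable.
  apply: (L0fun_measurable f0 (U := [set y | exists g : G, BX m (diag_conj g y)])).
  rewrite (_ : [set y | _] = \bigcup_g (diag_conj g : X -> X) @^-1` BX m).
    apply: bigcup_open => g _; apply: open_comp => // y _.
    exact: diag_conj_continuousr.
  by apply/seteqP; split=> [y [g gm]|y [g _ gm]]; exists g.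
suff A0 : mu A = 0%E.
  exists A; split=> // t /= /not_implyP[It /not_implyP[_ ng]]; exact: (conj It ng).
apply: contrapT => /eqP A0.
have {}A0 : (0 < mu A)%E by rewrite lt0e A0 measure_ge0.
have [e e0 eA] : exists2 e, 0 < e & (e%:E <= mu A)%E.
  move: A0; case: (mu A) => [e|_|//]; first by rewrite lte_fin => e0; exists e.
  by exists 1; rewrite // leey.
(* The open set [BX m], as a random open set that does not depend on [t]. *)
pose S (j : unit) : set (lebesgueR R) := setT.
pose W (j : unit) := BX m.
have mS j : measurable (I01 `&` S j) by rewrite setIT; exact: measurable_I01.
have oW j : open (W j) by exact: oBX.
have um : lebesgue_measurable_fun (fun _ : lebesgueR R => u).
  move=> U oU; rewrite (_ : _ `&` _ = I01 `&` [set t | U u /\ I01 t]).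
    by apply: prop_measurable; rewrite setIid; exact: measurable_I01.
  by apply/seteqP; split=> [t []|t [It []]].
have [a [[h _ ha]]] := comeager_L0_tuple_meets dm dt bB bBX dc ca0
  (@mostly_inside_open _ S W mS oW e) (ltac:(exists (class_tuple (MkL0fun um));
    rewrite /= (outside_ae_eq mS oW (tuple_fun_class (MkL0fun um)))
      (_ : outside _ _ _ = set0) ?measure0 ?lte_fin//;
    by apply/seteqP; split=> // t [_]; apply; exists tt)).
rewrite /= => /lt_le_trans/(_ eA); apply/negP; rewrite -leNgt.
apply: le_mu_ae => //; first exact: (outside_measurable mS oW).
have aeh := tuple_fun_diag_conj h a0; rewrite ha in aeh.
apply: filterS aeh => t ht [It ng]; split=> // -[j [_ Wt]]; apply: ng.
by exists ((repr h : L0fun R G) t); rewrite /f0 -ht.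
Qed.

End generic_tuples.

(** * Transfer from [L0 R G] to [G] *)

Lemma has_comeager_diag_class_of_L0 (R : realType) (G : polishGroupType R) n :
  has_comeager_diag_class (L0 R G) n -> has_comeager_diag_class G n.
Proof.
move=> [a ca].
have [d [dm dt dc]] := @polish_completely_metrizable R G.
have [B bB] := metric_countable_basis (1%g : G) dm dt (@polish_separable R G).
have [BX bBX] := ptws_countable_basis n bB.
have [N [mN N0 NP]] := filterI
  (generic_value_locally_dense dm dt bB bBX dc ca)
  (generic_value_dense_orbit dm dt bB bBX dc ca).
have [t It nNt] : exists2 t, I01 t & ~ N t.
  apply: contrapT => nt.
  have : (@completed_lebesgue_measure R I01 <= completed_lebesgue_measure N)%E.
    apply: le_mu => //; first exact: measurable_I01.
    by move=> t It; apply: contrapT => nNt; apply: nt; exists t.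
  by rewrite mu_I01 N0 lee_fin ler10.
have [ldt ddt] : locally_dense (diag_conj (H := G) (n := n)) (tuple_fun a t) /\
    dense (range (fun g : G => diag_conj g (tuple_fun a t))).
  have [H1 H2] :
      (I01 t -> locally_dense (diag_conj (H := G) (n := n)) (tuple_fun a t)) /\
      (I01 t -> dense (range (fun g : G => diag_conj g (tuple_fun a t)))).
    by apply: contrapT => nH; apply: nNt; exact: NP.
  by split; [exact: H1|exact: H2].
exists (tuple_fun a t).
exact: (locally_dense_comeager_orbit (@diag_conj1 G n) (@diag_conjM G n)
  (@diag_conj_continuousr G n) (@diag_conj_continuousl G n) dm dt dc
  (max_dist_metric n dm) (@max_dist_metrizes n _ _ _ dt) bBX ldt ddt).
Qed.

Theorem corollary3p3 (R : realType) (G : polishGroupType R) :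
  (forall n : nat, (1 <= n)%N ->
     has_comeager_diag_class (L0 R G) n -> has_comeager_diag_class G n) /\
  (ample_generics (L0 R G) -> ample_generics G).
Proof.
have main n : has_comeager_diag_class (L0 R G) n -> has_comeager_diag_class G n.
  exact: has_comeager_diag_class_of_L0.
by split=> [n _|agL n n1]; apply: main => //; exact: agL.
Qed.
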